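(* Let $m,p$ be positive integers and let $\mathbf{M}:\mathbb{Z}\to\mathbb{R}^{m\times p}$ satisfy $\mathbf{M}(\sigma)=0$ for all $\sigma<0$ and $\sum_{\sigma=0}^{\infty}\|\mathbf{M}(\sigma)\|<\infty$. Let $\mathbf{e}=\{\mathbf{e}(t),\,t\in\mathbb{Z}\}$ be normalized $p$-dimensional white Gaussian noise and let $$\mathbf{y}(t)=\sum_{\sigma=0}^{\infty}\mathbf{M}(\sigma)\,\mathbf{e}(t-\sigma),\qquad t\in\mathbb{Z}.$$ Let $\mathbf{R}_k:=\mathbb{E}\,\mathbf{y}(t+k)\mathbf{y}(t)^{\top}$ (independent of $t$) and $\mathbf{\Phi}(e^{i\theta}):=\sum_{k=-\infty}^{\infty}\mathbf{R}_k e^{-i\theta k}$ for $\theta\in[0,2\pi)$. Let $f:\mathbb{N}\to\mathbb{N}$ satisfy $\lim_{N\to\infty}f(N)=\infty$ and $\lim_{N\to\infty}f(N)^2/N=0$. For each sample size $N$ set $n:=f(N)$ and define, from the sample $\mathbf{y}(1),\dots,\mathbf{y}(N)$, the $f$-truncated periodogram $$\hat{\mathbf{\Phi}}(e^{i\theta}):=\sum_{k=-n}^{n}\hat{\mathbf{R}}_k e^{-i\theta k},$$ where the $\hat{\mathbf{R}}_k$ are either all the unbiased sample covariances or all the biased sample covariances (as defined in the context). Then, in either case, $\hat{\mathbf{\Phi}}$ is a uniformly mean-square consistent estimator of the spectral density, that is, with $\mathbf{\Delta}(e^{i\theta}):=\mathbf{\Phi}(e^{i\theta})-\hat{\mathbf{\Phi}}(e^{i\theta})$,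 $$\lim_{N\to\infty}\mathbb{E}\,\|\mathbf{\Delta}(e^{i\theta})\|^2=0\qquad\text{uniformly over }\theta\in[0,2\pi).$$
   Context: $\|\cdot\|$ denotes the Frobenius norm of a matrix. ''Normalized $p$-dimensional white Gaussian noise'' means that the $\mathbf{e}(t)$, $t\in\mathbb{Z}$, are independent real Gaussian random vectors in $\mathbb{R}^p$ with zero mean and identity covariance matrix; the series defining $\mathbf{y}(t)$ converges in mean square. Sample covariances from $\mathbf{y}(1),\dots,\mathbf{y}(N)$, for $0\le k\le n<N$: the unbiased one is $\hat{\mathbf{R}}_k:=\frac{1}{N-k}\sum_{t=1}^{N-k}\mathbf{y}(t+k)\mathbf{y}(t)^{\top}$; the biased one is $\hat{\mathbf{R}}_k:=\frac{1}{N}\sum_{t=1}^{N-k}\mathbf{y}(t+k)\mathbf{y}(t)^{\top}$. For negative lags, $\hat{\mathbf{R}}_{-k}:=\hat{\mathbf{R}}_k^{\top}$. The hypothesis $f(N)^2/N\to0$ ensures $n=f(N)<N$ for all sufficiently large $N$, and only such $N$ matter for the limit. *)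

(* Defs.v *)
From HB Require Import structures.
From mathcomp Require Import all_boot all_order all_algebra.
From mathcomp Require Import complex.
From mathcomp Require Import all_classical all_reals all_analysis.
Set Implicit Arguments.
Unset Strict Implicit.
Unset Printing Implicit Defensive.
Import Order.TTheory GRing.Theory Num.Theory.
Import numFieldNormedType.Exports.
Local Open Scope classical_set_scope.
Local Open Scope ring_scope.
Local Open Scope complex_scope.

Section Frobenius.
Variable R : realType.

Definition frob m n (A : 'M[R]_(m, n)) : R :=
  Num.sqrt (\sum_i \sum_j `|A i j| ^+ 2).

Definition frobC m n (A : 'M[R[i]]_(m, n)) : R :=
  Num.sqrt (\sum_i \sum_j Normc.normc (A i j) ^+ 2).

End Frobenius.

Section RandomVectors.
Context d (T : measurableType d) (R : realType) (P : probability T R).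

(* Borel sigma-algebra of R^p. *)
Definition borel_set p (B : set 'cV[R]_p) : Prop := <<s open>> B.

Definition random_vector p (X : T -> 'cV[R]_p) : Prop :=
  forall B, borel_set B -> measurable (X @^-1` B).

(* The degenerate normal laws are the Dirac masses; they are kept apart because
   normal_prob m 0 is, by the library's convention, a uniform law. *)
Definition gaussian_rv (X : T -> R) : Prop :=
  exists m : R,
    (forall A : set R, measurable A -> P (X @^-1` A) = \d_m A) \/
    (exists2 s : R, 0 < s &
       forall A : set R, measurable A -> P (X @^-1` A) = normal_prob m s A).

Definition gaussian_vector p (X : T -> 'cV[R]_p) : Prop :=
  random_vector X /\
  forall a : 'cV[R]_p, gaussian_rv (fun w => (a^T *m X w) 0 0).

Definition independent_vectors p (X : int -> T -> 'cV[R]_p) : Prop :=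
  forall (s : seq int) (B : int -> set 'cV[R]_p),
    uniq s -> (forall t, borel_set (B t)) ->
    (P (\bigcap_(t in [set` s]) (X t @^-1` B t)) =
     \prod_(t <- s) P (X t @^-1` B t))%E.

Record white_gaussian_noise p (e : int -> T -> 'cV[R]_p) : Prop := {
  wgn_gaussian : forall t, gaussian_vector (e t) ;
  wgn_independent : independent_vectors e ;
  wgn_mean : forall t i, ('E_P[fun w => e t w i 0%R] = 0)%E ;
  wgn_covariance : forall t i j,
    covariance P (fun w => e t w i 0%R) (fun w => e t w j 0%R)
    = ((1%:M : 'M[R]_p) i j)%:E }.

(* y(t) is the mean-square sum of M(s) e(t - s) over s >= 0. *)
Definition linear_process m p (M : int -> 'M[R]_(m, p))
    (e : int -> T -> 'cV[R]_p) (y : int -> T -> 'cV[R]_m) : Prop :=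
  forall t, random_vector (y t) /\
    'E_P[fun w =>
        (frob (y t w - \sum_(0 <= s < S) M s%:Z *m e (t - s%:Z) w) ^+ 2)%R]%E
      @[S --> \oo] --> 0%E.

(* E y(t+k) y(t)^T, entrywise. *)
Definition autocov m (y : int -> T -> 'cV[R]_m) (t k : int) : 'M[R]_m :=
  \matrix_(i, j) fine 'E_P[fun w => ((y (t + k) w *m (y t w)^T) i j)%R]%E.

End RandomVectors.

Section Spectrum.
Variable R : realType.

Definition expi (x : R) : R[i] := cos x +i* sin x.

(* The sum of r(k) e^{-i theta k} over -n <= k <= n, with k = j - n. *)
Definition fourier_sum m (r : int -> 'M[R]_m) (n : nat) (theta : R)
    : 'M[R[i]]_m :=
  \sum_(j < (2 * n).+1)
    expi (- (theta * (j%:Z - n%:Z)%:~R)) *: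
      map_mx (real_complex R) (r (j%:Z - n%:Z)).

(* Entrywise limit of the symmetric partial sums; R[i]^o carries the topology
   of the complex modulus. *)
Definition spectral_density m (r : int -> 'M[R]_m) (theta : R) : 'M[R[i]]_m :=
  \matrix_(i, j) limn (fun n => (fourier_sum r n theta i j : R[i]^o)).

End Spectrum.

Section Estimators.
Context (T : Type) (R : realType) (m : nat).
Implicit Types (y : int -> T -> 'cV[R]_m) (w : T).

Definition lag_sum y (N k : nat) w : 'M[R]_m :=
  \sum_(1 <= t < (N - k).+1) y (t + k)%N%:Z w *m (y t%:Z w)^T.

Definition unbiased_scov y (N k : nat) w : 'M[R]_m :=
  (N - k)%:R^-1 *: lag_sum y N k w.

Definition biased_scov y (N k : nat) w : 'M[R]_m :=
  N%:R^-1 *: lag_sum y N k w.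

Definition two_sided (r : nat -> 'M[R]_m) (k : int) : 'M[R]_m :=
  match k with Posz k => r k | Negz k => (r k.+1)^T end.

(* scov N k w is a sample covariance of lag k >= 0 from a sample of size N. *)
Definition truncated_periodogram (scov : nat -> nat -> T -> 'M[R]_m)
    (f : nat -> nat) (N : nat) (theta : R) w : 'M[R[i]]_m :=
  fourier_sum (two_sided (fun k => scov N k w)) (f N) theta.

End Estimators.

Definition uniformly_ms_consistent d (T : measurableType d) (R : realType)
    (P : probability T R) m (Phihat : nat -> R -> T -> 'M[R[i]]_m)
    (Phi : R -> 'M[R[i]]_m) : Prop :=
  forall eps : R, 0 < eps ->
    \forall N \near \oo, forall theta : R, 0 <= theta < 2 * pi ->
      ('E_P[fun w => (frobC (Phi theta - Phihat N theta w) ^+ 2)%R] < eps%:E)%E.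

(* Main.v *)
(** Only [n^2 / N -> 0] is available, so the error is estimated lag by lag: the
    squared sum of the [2n + 1] lag errors is at most [2n + 1] times the sum of
    their squares, and it suffices that every sample covariance has mean square
    error [O(1 / N)] uniformly in the lag.  For fixed [s], [s'] and [k] the centred
    products [e_a(t + k - s) e_b(t - s') - E] are pairwise orthogonal for distinct
    [t]: among the four time indices involved in two of them one occurs exactly
    once, unless both factors of each product are taken at the same time, and
    then the two products are independent.  Their sum over [N] times is thus
    [O(sqrt N)] in mean square; summing against the absolutely summable
    coefficients [M(s) M(s')] gives the claim for the finite truncations of [y],
    and the bound passes to [y] because a mean square bound survives L1
    limits.  Of the Gaussian law only the fourth moments are used. *)
Require Import Defs.
From HB Require Import structures.
From mathcomp Require Import all_boot all_order all_algebra.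
From mathcomp Require Import complex.
From mathcomp Require Import all_classical all_reals all_analysis measurable_realfun.
From mathcomp Require Import ring lra zify.
Import Order.TTheory GRing.Theory Num.Theory.
Import numFieldNormedType.Exports.
Local Open Scope classical_set_scope.
Local Open Scope ring_scope.
Set Implicit Arguments.
Unset Strict Implicit.
Unset Printing Implicit Defensive.

(** * Fourth moments of Gaussian variables *)

(** The error of one matrix entry has three parts: the tail of the covariance series beyond lag [n],
    the bias of the sample covariances, and their random deviation from the mean. The first two are
    deterministic. The deviations at different lags are not shown to be uncorrelated, so the third
    costs [(2n + 1)^2] times [O(1/N)]; this is where [n^2 / N -> 0] is spent. The frequency enters
    only through cosines and sines, bounded by 1, so all bounds are uniform in [theta]. Both
    estimators are weighted lag sums with weights [O(1/N)] and relative bias at most [n^2 / N], and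
    are treated together.

    Two obstacles shape the rest. [gaussian_rv] only asserts that some parameters exist, so they
    have to be bounded from the unit second moment. And [y] is only a mean-square limit: products of
    its truncations converge in L1 without further moment bounds, which is why second moments of lag
    sums are carried over by a truncation argument. Numerical constants matter only in being
    independent of time, lag and truncation order. *)

Lemma integral_normal_prob (R : realType) (m s : R) (h : R -> R) :
  measurable_fun [set: R] h -> (forall x, 0 <= h x) ->
  (\int[normal_prob m s]_x (h x)%:E =
   \int[lebesgue_measure]_x (h x * normal_pdf m s x)%:E)%E.
Proof.
move=> mh h0.
pose hE : R -> \bar R := EFin \o h; pose pE : R -> \bar R := EFin \o normal_pdf m s.
have mf : measurable_fun [set: R] hE by exact/measurable_EFinP.
have mpdf : measurable_fun [set: R] pE.
  by apply/measurable_EFinP; exact: measurable_normal_pdf.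
have dom := normal_prob_dominates m s.
rewrite -(Radon_Nikodym_SigmaFinite.change_of_variables dom (f := hE))//.
under [RHS]eq_integral do rewrite EFinM.
apply: ae_eq_integral => //=.
- apply: emeasurable_funM => //.
  exact: measurable_int (Radon_Nikodym_SigmaFinite.f_integrable dom).
- exact: emeasurable_funM.
(* The Radon-Nikodym derivative is determined only almost everywhere; it agrees with [normal_pdf]
   because both have the same integral over every measurable set. *)
apply: ae_eqe_mul2l => /=; apply: integral_ae_eq => //=.
- exact: Radon_Nikodym_SigmaFinite.f_integrable.
- by move=> A _ mA; rewrite -Radon_Nikodym_SigmaFinite.f_integral.
Qed.

Lemma normal_peak_le (R : realType) (s : R) : 0 < s -> normal_peak s <= (2 * s)^-1.
Proof.
move=> s0; rewrite /normal_peak lef_pV2 ?posrE ?sqrtr_gt0 ?mulr_gt0//; last first.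
  by rewrite pmulrn_rgt0// mulr_gt0 ?exprn_gt0 ?pi_gt0.
have /ger0_norm <- : 0 <= 2 * s by lra.
rewrite -sqrtr_sqr; apply: ler_wsqrtr.
have := pi_ge2 R; nra.
Qed.

(* With [u = (x - m)^2 / s^2], a power of [u] times [expR (- u / 2)] is dominated
   by [expR (- u / 8)], the exponential of the density of twice the scale. *)
Lemma normal_pdf_moment_le (R : realType) (m s x : R) : 0 < s ->
  (x - m) ^+ 4 * normal_pdf m s x <= 58 * s ^+ 4 * normal_pdf m (2 * s) x /\
  (x - m) ^+ 2 * normal_pdf m s x <= 6 * s ^+ 2 * normal_pdf m (2 * s) x.
Proof.
move=> s0; have s20 : 0 < 2 * s by rewrite mulr_gt0.
rewrite !normal_pdfE ?gt_eqF//.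
have -> : normal_peak s = 2 * normal_peak (2 * s).
  rewrite /normal_peak.
  have -> : ((2 * s) ^+ 2 * pi *+ 2) = 2 ^+ 2 * (s ^+ 2 * pi *+ 2) by rewrite exprMn; ring.
  by rewrite sqrtrM ?sqr_ge0// sqrtr_sqr ger0_norm// invfM mulrA divff// mul1r.
have p0 := normal_peak_ge0 (2 * s).
pose u := (x - m) ^+ 2 / s ^+ 2.
have u0 : 0 <= u by rewrite mulr_ge0 ?sqr_ge0// invr_ge0 sqr_ge0.
have xu : (x - m) ^+ 2 = s ^+ 2 * u by rewrite mulrC divfK// expf_neq0// gt_eqF.
have -> : normal_fun m s x = expR (- (u / 2)).
  by rewrite /normal_fun; congr expR; rewrite xu; field; rewrite gt_eqF.
have -> : normal_fun m (2 * s) x = expR (- (u / 2)) * expR (u * 3 / 16) ^+ 2.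
  rewrite -expRM_natl -expRD /normal_fun; congr expR; rewrite xu.
  by field; rewrite gt_eqF.
have := expR_ge1Dx (u * 3 / 16); set E := expR (u * 3 / 16) => E1.
have := expR_ge0 (- (u / 2)); set F := expR _ => F0.
have -> : (x - m) ^+ 4 = s ^+ 4 * u ^+ 2 by rewrite (exprM _ 2 2) xu; ring.
rewrite xu.
have E2 : (1 + u * 3 / 16) ^+ 2 <= E ^+ 2 by rewrite lerXn2r ?nnegrE//; lra.
have s4 k : 0 <= s ^+ k by rewrite exprn_ge0// ltW.
(* [E2] gives [E^2 >= 9 u^2 / 256] and [E^2 >= 1 + 3 u / 8], hence [29 E^2 >= u^2] and [3 E^2 >= u].
   The factor 2 between the two peaks turns 29 and 3 into 58 and 6. *)
split; rewrite -subr_ge0.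
  have -> : 58 * s ^+ 4 * (normal_peak (2 * s) * (F * E ^+ 2)) -
     s ^+ 4 * u ^+ 2 * (2 * normal_peak (2 * s) * F) =
     2 * (s ^+ 4 * normal_peak (2 * s) * F) * (29 * E ^+ 2 - u ^+ 2) by ring.
  rewrite mulr_ge0//; first by rewrite mulr_ge0// mulr_ge0// mulr_ge0.
  nra.
have -> : 6 * s ^+ 2 * (normal_peak (2 * s) * (F * E ^+ 2)) -
     s ^+ 2 * u * (2 * normal_peak (2 * s) * F) =
     2 * (s ^+ 2 * normal_peak (2 * s) * F) * (3 * E ^+ 2 - u) by ring.
rewrite mulr_ge0//; first by rewrite mulr_ge0// mulr_ge0// mulr_ge0.
nra.
Qed.

Lemma ge0_integral_law d (T : measurableType d) (R : realType)
    (P : probability T R) (X : T -> R) (Q : probability (measurableTypeR R) R) (h : R -> R) :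
  measurable_fun setT X -> (forall A : set R, measurable A -> P (X @^-1` A) = Q A) ->
  measurable_fun [set: R] h -> (forall x, 0 <= h x) ->
  (\int[P]_w (h (X w))%:E = \int[Q]_x (h x)%:E)%E.
Proof.
move=> mX PQ mh h0.
have mX' : @measurable_fun _ _ T (measurableTypeR R) setT X by [].
pose X' : {RV P >-> measurableTypeR R} :=
  HB.pack (X : T -> measurableTypeR R) (isMeasurableFun.Build _ _ _ _ _ mX').
have mf : measurable_fun [set: R] (fun x => (h x)%:E) by exact/measurable_EFinP.
rewrite (eq_measure_integral (distribution P X')); last first.
  by move=> A mA _; exact/esym/PQ.
by rewrite ge0_integral_distribution.
Qed.

(* The parameters of the law are bounded without computing its moments exactly:
   the density is at most [(2 s)^-1], so [|X| > s / 2] has probability at least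
   [1/2], which gives [s^2 <= 8] and then [m^2 <= 98]. *)
Lemma gaussian_fourth_moment d (T : measurableType d) (R : realType)
    (P : probability T R) (X : T -> R) :
  measurable_fun setT X -> gaussian_rv P X ->
  (\int[P]_w (X w ^+ 2)%:E = 1)%E ->
  (\int[P]_w (X w ^+ 4)%:E <= (8 * 58 * 8 ^+ 2 + 8 * 98 ^+ 2)%:E)%E.
Proof.
move=> mX [m gX] X2.
have mXn k (c : R) : measurable_fun [set: R] (fun x : R => (x - c) ^+ k).
  by apply: measurable_funX; exact: measurable_funB.
have mXk k : measurable_fun [set: R] (fun x : R => x ^+ k) by exact: measurable_funX.
have x4 (x : R) : 0 <= x ^+ 4 by rewrite exprn_even_ge0.
case: gX => [PX|[s s0 PX]].
  have law := ge0_integral_law (P := P) (Q := dirac (m : measurableTypeR R)) mX PX.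
  have m2 : m ^+ 2 = 1.
    have := law _ (mXk 2%N) (fun x => sqr_ge0 x); rewrite X2 integral_dirac//=; last first.
      exact/measurable_EFinP.
    by rewrite diracT mul1e => -[].
  rewrite (law _ (mXk 4%N))// integral_dirac//=; last exact/measurable_EFinP.
  by rewrite diracT mul1e (exprM _ 2 2) m2 lee_fin; lra.
have law := ge0_integral_law (P := P) (Q := normal_prob m s) mX PX.
have s20 : 0 < 2 * s by lra.
have mpdf a b : measurable_fun [set: R] (normal_pdf a b : R -> R).
  exact: measurable_normal_pdf.
have pdf0 := @normal_pdf_ge0 R.
have X2' : (\int[lebesgue_measure]_x (x ^+ 2 * normal_pdf m s x)%:E = 1)%E.
  rewrite -integral_normal_prob//; last by move=> x; exact: sqr_ge0.
  by rewrite -law// => x; exact: sqr_ge0.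
have mF k a b c : measurable_fun [set: R] (fun x : R => ((x - c) ^+ k * normal_pdf a b x)%:E).
  by apply/measurable_EFinP; apply: measurable_funM.
have mG a b c : measurable_fun [set: R] (fun x : R => (c * normal_pdf a b x)%:E).
  by apply/measurable_EFinP; apply: measurable_funM.
have cent k c : 0 <= c ->
    (forall x, (x - m) ^+ k * normal_pdf m s x <= c * normal_pdf m (2 * s) x) ->
    (forall x, 0 <= (x - m) ^+ k) ->
    (\int[lebesgue_measure]_x ((x - m) ^+ k * normal_pdf m s x)%:E <= c%:E)%E.
  move=> c0 hc hk.
  apply: (@le_trans _ _ (\int[lebesgue_measure]_x (c * normal_pdf m (2 * s) x)%:E)%E).
    apply: ge0_le_integral => //=.
    - by move=> x _; rewrite lee_fin mulr_ge0.
    - exact: mF.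
    - exact: mG.
    - by move=> x _; rewrite lee_fin.
  under eq_integral do rewrite EFinM.
  rewrite ge0_integralZl//=; last 2 first.
  - by apply/measurable_EFinP; exact: mpdf.
  - by move=> x _; rewrite lee_fin.
  by rewrite integral_normal_pdf mule1.
have s2ge0 : 0 <= s ^+ 2 by exact: sqr_ge0.
have s4ge0 : 0 <= s ^+ 4 by exact: x4.
have {}c4 : (\int[P]_w ((X w - m) ^+ 4)%:E <= (58 * s ^+ 4)%:E)%E.
  rewrite (law (fun x => (x - m) ^+ 4)) ?integral_normal_prob//.
  apply: cent => //; first by rewrite mulr_ge0.
  by move=> x; exact: (normal_pdf_moment_le m x s0).1.
have {}c2 : (\int[P]_w ((X w - m) ^+ 2)%:E <= (6 * s ^+ 2)%:E)%E.
  rewrite (law (fun x => (x - m) ^+ 2)) ?integral_normal_prob//; [|by move=> x; exact: sqr_ge0..].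
  apply: cent => //; first by rewrite mulr_ge0.
    by move=> x; exact: (normal_pdf_moment_le m x s0).2.
  by move=> x; exact: sqr_ge0.
have s8 : s ^+ 2 <= 8.
  have h4 : 0 <= 4 / s ^+ 2 by rewrite divr_ge0.
  suff : (1 <= (4 / s ^+ 2)%:E + (2^-1 : R)%:E)%E.
    rewrite -EFinD lee_fin => h.
    have : s ^+ 2 * 1 <= s ^+ 2 * (4 / s ^+ 2 + 2^-1) by rewrite ler_wpM2l.
    by rewrite mulrDr mulrCA divff ?expf_neq0 ?gt_eqF//; lra.
  rewrite -[leLHS](integral_normal_pdf m s).
  (* Chebyshev's argument under the integral: on [J] the density is at most its peak, off [J] one
     has [1 <= 4 x^2 / s^2]. The interval is centred at 0 and not at the mean, because the known
     second moment is about 0. *)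
  pose J := `[(- s / 2)%R, (s / 2)%R]%classic : set R.
  have mJ : measurable J by exact: measurable_itv.
  have mk : measurable_fun [set: R] (fun x : R => (4 / s ^+ 2)%:E * (x ^+ 2 * normal_pdf m s x)%:E)%E.
    by apply/measurable_funeM/measurable_EFinP; apply: measurable_funM.
  have mJ' : measurable_fun [set: R] (fun x : R => (normal_peak s)%:E * (\1_J x)%:E)%E.
    by apply/measurable_funeM/measurable_EFinP; exact: measurable_indic.
  apply: (@le_trans _ _ (\int[lebesgue_measure]_x ((4 / s ^+ 2)%:E * (x ^+ 2 * normal_pdf m s x)%:E +
     (normal_peak s)%:E * (\1_J x)%:E))%E).
    apply: ge0_le_integral => //=.
    - by move=> x _; rewrite lee_fin.
    - by apply/measurable_EFinP; exact: mpdf.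
    - exact: emeasurable_funD.
    - move=> x _; rewrite -!EFinM -EFinD lee_fin.
      have [xJ|xJ] := boolP (x \in J).
        rewrite indicE xJ mulr1 (le_trans (normal_pdf_ub m x (lt0r_neq0 s0)))// lerDr.
        by rewrite mulr_ge0// mulr_ge0// sqr_ge0.
      rewrite indicE (negbTE xJ) mulr0 addr0 mulrA ler_peMl//.
      rewrite mulrAC ler_pdivlMr ?exprn_gt0// mul1r.
      move: xJ; rewrite notin_setE /J/= in_itv/= => /negP; rewrite negb_and -!ltNge => /orP[h|h]; nra.
  rewrite ge0_integralD//=; last 2 first.
  - by move=> x _; rewrite -EFinM lee_fin mulr_ge0// mulr_ge0// sqr_ge0.
  - by move=> x _; rewrite -EFinM lee_fin mulr_ge0 ?normal_peak_ge0.
  rewrite ge0_integralZl//=; last 2 first.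
  - by apply/measurable_EFinP; apply: (measurable_funM (mXk 2%N)); exact: mpdf.
  - by move=> x _; rewrite lee_fin mulr_ge0// sqr_ge0.
  rewrite ge0_integralZl//=; last 2 first.
  - by apply/measurable_EFinP; exact: measurable_indic.
  - by rewrite lee_fin normal_peak_ge0.
  rewrite X2' mule1 integral_indic//= setIT lebesgue_measure_itv/=.
  rewrite lte_fin ifT; last lra.
  rewrite leeD2l// -EFinB -EFinM lee_fin.
  have := normal_peak_le s0; rewrite -[X in _ <= X]mul1r ler_pdivlMr//.
  nra.
(* Writing [m = X - (X - m)] and taking expectations gives [m^2 <= 2 + 12 s^2], which is at most 98
   since [s^2 <= 8]. *)
have m98 : m ^+ 2 <= 98.
  suff : ((m ^+ 2)%:E <= 2%:E * 1 + 2%:E * (6 * s ^+ 2)%:E)%E.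
    by rewrite mule1 -EFinM -EFinD lee_fin; lra.
  apply: (@le_trans _ _ (\int[P]_w (2%:E * (X w ^+ 2)%:E + 2%:E * ((X w - m) ^+ 2)%:E))%E).
    rewrite -[leLHS]mule1 -(probability_setT P) -integral_cst//.
    apply: ge0_le_integral => //=.
    - by move=> x _; rewrite lee_fin sqr_ge0.
    - by apply: emeasurable_funD; apply/measurable_funeM/measurable_EFinP;
        apply: measurable_funX => //; exact: measurable_funB.
    - by move=> w _; rewrite -!EFinM -EFinD lee_fin; have := sqr_ge0 (2 * X w - m); lra.
  rewrite ge0_integralD//=; last 4 first.
  - by move=> w _; rewrite -EFinM lee_fin mulr_ge0// sqr_ge0.
  - by apply/measurable_funeM/measurable_EFinP; apply: measurable_funX.
  - by move=> w _; rewrite -EFinM lee_fin mulr_ge0// sqr_ge0.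
  - by apply/measurable_funeM/measurable_EFinP; apply: measurable_funX => //; exact: measurable_funB.
  rewrite !ge0_integralZl//=; last 4 first.
  - by apply/measurable_EFinP; apply: measurable_funX => //; exact: measurable_funB.
  - by move=> w _; rewrite lee_fin sqr_ge0.
  - by apply/measurable_EFinP; apply: measurable_funX.
  - by move=> w _; rewrite lee_fin sqr_ge0.
  by rewrite X2 leeD2l// lee_wpmul2l// lee_fin.
apply: (@le_trans _ _ (\int[P]_w (8%:E * ((X w - m) ^+ 4)%:E + (8 * m ^+ 4)%:E))%E).
  apply: ge0_le_integral => //=.
  - by move=> w _; rewrite lee_fin.
  - by apply/measurable_EFinP; apply: measurable_funX.
  - apply: emeasurable_funD => //; apply/measurable_funeM/measurable_EFinP.
    by apply: measurable_funX => //; exact: measurable_funB.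
  - move=> w _; rewrite -!EFinM -EFinD lee_fin.
    have h : X w ^+ 2 <= 2 * (X w - m) ^+ 2 + 2 * m ^+ 2.
      by have := sqr_ge0 (X w - 2 * m); lra.
    have : (X w ^+ 2) ^+ 2 <= (2 * (X w - m) ^+ 2 + 2 * m ^+ 2) ^+ 2.
      by rewrite lerXn2r ?nnegrE ?sqr_ge0// addr_ge0// mulr_ge0// sqr_ge0.
    by have := sqr_ge0 ((X w - m) ^+ 2 - m ^+ 2); lra.
rewrite ge0_integralD//=; last 3 first.
- by move=> w _; rewrite -EFinM lee_fin mulr_ge0.
- by apply/measurable_funeM/measurable_EFinP; apply: measurable_funX => //; exact: measurable_funB.
- by move=> w _; rewrite lee_fin mulr_ge0.
rewrite ge0_integralZl//=; last 2 first.
- by apply/measurable_EFinP; apply: measurable_funX => //; exact: measurable_funB.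
- by move=> w _; rewrite lee_fin.
have -> : (\int[P]__ (8 * m ^+ 4)%:E = (8 * m ^+ 4)%:E)%E.
  by rewrite -[RHS]mule1 -(probability_setT P) -integral_cst.
rewrite [leRHS]EFinD leeD//.
  rewrite (le_trans (lee_wpmul2l _ c4))// -EFinM lee_fin -mulrA !ler_wpM2l//.
  by rewrite (exprM _ 2 2) lerXn2r ?nnegrE.
by rewrite lee_fin ler_wpM2l// (exprM _ 2 2) lerXn2r ?nnegrE ?sqr_ge0.
Qed.

(** * Square-integrable variables and independence *)

Section SquareIntegrable.
Context d (T : measurableType d) (R : realType) (P : probability T R).
Implicit Types X Y : T -> R.

Definition L1 X := P.-integrable setT (EFin \o X).

(** Measurability is required separately, since that of [X^2] does not imply that of [X]. *)
Definition L2 X := measurable_fun setT X /\ L1 (fun w => X w ^+ 2).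

Local Notation E X := (Rintegral P setT X).

Lemma L1_measurable X : L1 X -> measurable_fun setT X.
Proof. by move=> /measurable_int /measurable_EFinP. Qed.

Lemma L1_cst (c : R) : L1 (fun=> c).
Proof. exact: finite_measure_integrable_cst. Qed.

Lemma L1_add X Y : L1 X -> L1 Y -> L1 (fun w => X w + Y w).
Proof. exact: integrableD. Qed.

Lemma L1_sub X Y : L1 X -> L1 Y -> L1 (fun w => X w - Y w).
Proof. exact: integrableB. Qed.

Lemma L1_scale (c : R) X : L1 X -> L1 (fun w => c * X w).
Proof. exact: integrableZl. Qed.

Lemma L1_norm X : L1 X -> L1 (fun w => `|X w|).
Proof. exact: integrable_norm. Qed.

Lemma L1_sum I (r : seq I) (F : I -> T -> R) :
  (forall i, L1 (F i)) -> L1 (fun w => \sum_(i <- r) F i w).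
Proof.
move=> hF; elim: r => [|i r ih].
  by under eq_fun do rewrite big_nil; exact: L1_cst.
by under eq_fun do rewrite big_cons; exact: L1_add.
Qed.

Lemma L1_le X Y : measurable_fun setT X -> (forall w, `|X w| <= Y w) -> L1 Y -> L1 X.
Proof.
move=> mX XY; apply: le_integrable => //; first exact/measurable_EFinP.
by move=> w _ /=; rewrite lee_fin (le_trans (XY w))// ler_norm.
Qed.

Lemma E_cst (c : R) : E (fun=> c) = c.
Proof. by rewrite Rintegral_cst//= probability_setT mulr1. Qed.

Lemma E_sum I (r : seq I) (F : I -> T -> R) : (forall i, L1 (F i)) ->
  E (fun w => \sum_(i <- r) F i w) = \sum_(i <- r) E (F i).
Proof.
move=> hF; elim: r => [|i r ih].
  by rewrite big_nil; under eq_Rintegral do rewrite big_nil; rewrite E_cst.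
rewrite big_cons -ih -RintegralD; [|by []|exact: hF|exact: L1_sum].
by apply: eq_Rintegral => w _; rewrite big_cons.
Qed.

Lemma EFin_E X : L1 X -> ((E X)%:E = \int[P]_w (X w)%:E)%E.
Proof. by move=> hX; rewrite /Rintegral fineK// integrable_fin_num. Qed.

Lemma L1_of_ge0_lty X : measurable_fun setT X -> (forall w, 0 <= X w) ->
  (\int[P]_w (X w)%:E < +oo)%E -> L1 X.
Proof.
move=> mX X0 hX; apply/integrableP; split; first exact/measurable_EFinP.
by under eq_integral => w _ do rewrite /= ger0_norm//.
Qed.

Lemma L2_L1_mul X Y : L2 X -> L2 Y -> L1 (fun w => X w * Y w).
Proof.
move=> [mX X2] [mY Y2]; apply: (@L1_le _ (fun w => X w ^+ 2 + Y w ^+ 2)).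
- exact: measurable_funM.
- move=> w; rewrite ler_norml; apply/andP; split.
    by have := sqr_ge0 (X w + Y w); have := sqr_ge0 (X w); have := sqr_ge0 (Y w); lra.
  by have := sqr_ge0 (X w - Y w); have := sqr_ge0 (X w); have := sqr_ge0 (Y w); lra.
- exact: L1_add.
Qed.

Lemma L2_cst (c : R) : L2 (fun=> c).
Proof. by split => //; exact: L1_cst. Qed.

Lemma L2_L1 X : L2 X -> L1 X.
Proof.
move=> hX; have := L2_L1_mul hX (L2_cst 1).
by under eq_fun do rewrite mulr1.
Qed.

Lemma L2_add X Y : L2 X -> L2 Y -> L2 (fun w => X w + Y w).
Proof.
move=> hX hY; split; first by apply: measurable_funD; [case: hX|case: hY].
under eq_fun do rewrite sqrrD.
apply: L1_add; last by case: hY.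
apply: L1_add; first by case: hX.
under eq_fun do rewrite -mulr_natl.
exact/L1_scale/L2_L1_mul.
Qed.

Lemma L2_scale (c : R) X : L2 X -> L2 (fun w => c * X w).
Proof.
move=> [mX X2]; split; first exact: measurable_funM.
by under eq_fun do rewrite exprMn; exact: L1_scale.
Qed.

Lemma L2_sub X Y : L2 X -> L2 Y -> L2 (fun w => X w - Y w).
Proof.
move=> hX hY; under eq_fun do rewrite -mulN1r.
exact/(L2_add hX)/L2_scale.
Qed.

Lemma L2_sum I (r : seq I) (F : I -> T -> R) :
  (forall i, L2 (F i)) -> L2 (fun w => \sum_(i <- r) F i w).
Proof.
move=> hF; elim: r => [|i r ih].
  by under eq_fun do rewrite big_nil; exact: L2_cst.
by under eq_fun do rewrite big_cons; exact: L2_add.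
Qed.

(** Independence makes the joint law of [(X, Y)] the product of the marginal laws, by uniqueness of
    the product measure. Tonelli applied to [|x y|] then gives integrability of the product, and
    Fubini its value. *)
Lemma E_mul_indep X Y : L1 X -> L1 Y ->
  (forall A B : set R, measurable A -> measurable B ->
    P (X @^-1` A `&` Y @^-1` B) = (P (X @^-1` A) * P (Y @^-1` B))%E) ->
  L1 (fun w => X w * Y w) /\ E (fun w => X w * Y w) = E X * E Y.
Proof.
move=> hX hY XY.
have mX := L1_measurable hX; have mY := L1_measurable hY.
pose X' : {RV P >-> R} := HB.pack X (isMeasurableFun.Build _ _ _ _ _ mX).
pose Y' : {RV P >-> R} := HB.pack Y (isMeasurableFun.Build _ _ _ _ _ mY).
pose Z : T -> R * R := fun w => (X w, Y w).
have mZ : measurable_fun setT Z by exact: measurable_fun_pair.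
pose Z' : {RV P >-> (R * R)%type} := HB.pack Z (isMeasurableFun.Build _ _ _ _ _ mZ).
pose f : R * R -> \bar R := fun z => (z.1 * z.2)%:E.
have mf : measurable_fun setT f.
  by apply/measurable_EFinP; apply: measurable_funM; [exact: measurable_fst|exact: measurable_snd].
have prodZ C : measurable C -> ((distribution P X' \x distribution P Y') C = distribution P Z' C)%E.
  by apply: product_measure_unique => A B mA mB; exact: XY.
have iX : (distribution P X').-integrable setT (fun x : R => x%:E).
  by apply: integrable_pushforward => //; exact/measurable_EFinP.
have iY : (distribution P Y').-integrable setT (fun x : R => x%:E).
  by apply: integrable_pushforward => //; exact/measurable_EFinP.
have FE x : (\int[distribution P Y']_y f (x, y) = x%:E * \int[distribution P Y']_y y%:E)%E.
  by rewrite -integralZl.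
have eX : (\int[distribution P X']_x x%:E = (E X)%:E)%E.
  by rewrite integral_distribution// EFin_E.
have eY : (\int[distribution P Y']_x x%:E = (E Y)%:E)%E.
  by rewrite integral_distribution// EFin_E.
have ipf : (distribution P X' \x distribution P Y')%E.-integrable setT f.
  apply: (iffRL (integrable12ltyP (distribution P X') (distribution P Y') mf)).
  have -> : (\int[distribution P X']_x \int[distribution P Y']_y `|f (x, y)| =
     \int[distribution P X']_x (`|x%:E| * \int[distribution P Y']_y `|y%:E|))%E.
    apply: eq_integral => x _; rewrite -ge0_integralZl//.
    - by apply: eq_integral => y _; rewrite /f /= normrM.
    - exact/measurableT_comp.
  have /integrableP[_ hY1] := iY; have /integrableP[_ hX1] := iX.
  rewrite ge0_integralZr//; last exact: integral_ge0.
  - by rewrite lte_mul_pinfty// ?integral_ge0// ge0_fin_numE// integral_ge0.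
  - exact/measurableT_comp.
have L1Z : P.-integrable setT (f \o Z).
  apply/integrableP; split; first exact: measurableT_comp.
  have := @ge0_integral_distribution _ _ _ _ _ P Z' (fun z => `|f z|)%E.
  have maf : measurable_fun setT (fun z => `|f z|)%E by exact: measurableT_comp.
  move=> /(_ maf (fun z => abse_ge0 _))/= <-.
  rewrite (eq_measure_integral (distribution P X' \x distribution P Y')%E).
    by have /integrableP[_] := ipf.
  by move=> C mC _; exact/esym/prodZ.
split; first exact: L1Z.
apply: EFin_inj; rewrite (EFin_E L1Z).
have := @integral_distribution _ _ _ _ _ P Z' f mf L1Z => /= <-.
rewrite (eq_measure_integral (distribution P X' \x distribution P Y')%E)//; last first.
  by move=> C mC _; exact/esym/prodZ.
rewrite -integral12_prod_meas1// /fubini_F.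
under eq_integral do rewrite FE eY.
by rewrite integralZr// eX EFinM.
Qed.

End SquareIntegrable.

(** * White noise *)

Section Orthogonal.
Context d (T : measurableType d) (R : realType) (P : probability T R).
Local Notation E X := (Rintegral P setT X).

Lemma E_sqr_sum_orthogonal (I : eqType) (r : seq I) (F : I -> T -> R) (B : R) :
  uniq r -> (forall i, L2 P (F i)) ->
  (forall i j, i != j -> E (fun w => F i w * F j w) = 0) ->
  (forall i, E (fun w => F i w ^+ 2) <= B) ->
  E (fun w => (\sum_(i <- r) F i w) ^+ 2) <= (size r)%:R * B.
Proof.
move=> + F2 F0 FB; elim: r => [|i r ih] /=.
  move=> _; rewrite mul0r; under eq_Rintegral do rewrite big_nil expr0n/=.
  by rewrite E_cst.
move=> /andP[ir ur]; have {}ih := ih ur.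
have S2 : L2 P (fun w => \sum_(j <- r) F j w) by exact: L2_sum.
have iS : E (fun w => F i w * \sum_(j <- r) F j w) = 0.
  under eq_Rintegral do rewrite mulr_sumr.
  rewrite E_sum; last by move=> j; exact: L2_L1_mul.
  rewrite big_seq big1// => j jr; apply: F0.
  by apply: contraNneq ir => ->.
have -> : E (fun w => (\sum_(j <- i :: r) F j w) ^+ 2) =
    E (fun w => F i w ^+ 2 + (2 * (F i w * \sum_(j <- r) F j w) + (\sum_(j <- r) F j w) ^+ 2)).
  by apply: eq_Rintegral => w _; rewrite big_cons; ring.
have i2 : L1 P (fun w => F i w ^+ 2) by have [] := F2 i.
have S22 : L1 P (fun w => (\sum_(j <- r) F j w) ^+ 2) by have [] := S2.
have iS1 : L1 P (fun w => F i w * \sum_(j <- r) F j w) by exact: L2_L1_mul.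
rewrite RintegralD//; last by apply: L1_add => //; exact: L1_scale.
rewrite RintegralD//; last exact: L1_scale.
by rewrite RintegralZl// iS mulr0 add0r -natr1 mulrDl mul1r addrC lerD.
Qed.

End Orthogonal.

Section Noise.
Context d (T : measurableType d) (R : realType) (P : probability T R) (p : nat).
Local Notation E X := (Rintegral P setT X).
Local Notation Bor := (g_sigma_algebraType (@open 'cV[R]_p)).

Lemma borel_measurable_coord (a : 'I_p) :
  @measurable_fun _ _ Bor R setT (fun v : 'cV[R]_p => v a 0).
Proof.
apply: (measurability _ (RGenOpens.measurableE R)) => _ [_ [x [y ->]] <-].
rewrite setTI; apply: sub_sigma_algebra.
apply: open_comp; last exact: interval_open.
by move=> v _; exact: coord_continuous.
Qed.

Lemma random_vector_comp (X : T -> 'cV[R]_p) (phi : 'cV[R]_p -> R) :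
  random_vector X -> @measurable_fun _ _ Bor R setT phi ->
  measurable_fun setT (fun w => phi (X w)).
Proof.
move=> rX mphi _ A mA; rewrite setTI; apply: (rX (phi @^-1` A)).
by have := mphi measurableT A mA; rewrite setTI.
Qed.

Context (e : int -> T -> 'cV[R]_p).

(* A pi-system generating the sigma-algebra of all [e t] with [t != u]. *)
Definition cylinders_off (u : int) : set (set T) :=
  [set C | exists s (B : int -> set 'cV[R]_p),
    [/\ uniq s, u \notin s, forall t, borel_set (B t) &
        C = \bigcap_(t in [set` s]) (e t @^-1` B t)]].

Local Notation off u := (g_sigma_algebraType (cylinders_off u)).

Lemma borel_setT : borel_set [set: 'cV[R]_p].
Proof. exact: (@measurableT _ Bor). Qed.

Lemma borel_setI (A B : set 'cV[R]_p) : borel_set A -> borel_set B -> borel_set (A `&` B).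
Proof. exact: (@measurableI _ Bor). Qed.

Lemma cylinders_off_measurable (u : int) : (forall t, random_vector (e t)) ->
  cylinders_off u `<=` measurable.
Proof.
move=> re _ [s [B [_ _ bB ->]]].
apply: fin_bigcap_measurable => //. by move=> t _; exact: re.
Qed.

Lemma cylinders_off_setI (u : int) : setI_closed (cylinders_off u).
Proof.
move=> _ _ [s1 [B1 [u1 n1 b1 ->]]] [s2 [B2 [u2 n2 b2 ->]]].
exists (undup (s1 ++ s2)), (fun t => (if t \in s1 then B1 t else setT) `&`
  (if t \in s2 then B2 t else setT)); split.
- exact: undup_uniq.
- by rewrite mem_undup mem_cat negb_or n1.
- by move=> t; apply: borel_setI; case: ifP => // _; exact: borel_setT.
- apply/seteqP; split => [w [h1 h2] t /= _|w h].
    by split; case: ifP => // ts; [exact: h1|exact: h2].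
  by split => t /= ts; have [] := h t; rewrite /= ?mem_undup ?mem_cat ?ts ?orbT.
Qed.

Lemma off_measurable_coord (u t : int) (a : 'I_p) : t != u ->
  @measurable_fun _ _ (off u) R setT (fun w => e t w a 0).
Proof.
move=> tu _ A mA; rewrite setTI; apply: sub_sigma_algebra.
exists [:: t], (fun=> (fun v : 'cV[R]_p => v a 0) @^-1` A); split => //.
- by rewrite inE eq_sym.
- by move=> _; have := borel_measurable_coord a measurableT mA; rewrite setTI.
- apply/seteqP; split => [w h s /=|w h].
    by rewrite inE => /eqP ->.
  by apply: h; rewrite /= inE.
Qed.

(** With [C] the event on [e u], the finite measures sending [D] to [P (D & C)] and to [P C * P D]
    agree on the pi-system of cylinders avoiding [u], hence on the sigma-algebra it generates. *)
Lemma indep_off (u : int) (phi : 'cV[R]_p -> R) (W : T -> R) :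
  (forall t, random_vector (e t)) -> independent_vectors P e ->
  @measurable_fun _ _ Bor R setT phi -> @measurable_fun _ _ (off u) R setT W ->
  forall A B : set R, measurable A -> measurable B ->
    P ((fun w => phi (e u w)) @^-1` A `&` W @^-1` B) =
    (P ((fun w => phi (e u w)) @^-1` A) * P (W @^-1` B))%E.
Proof.
move=> re ie mphi mW A B mA mB.
set C := _ @^-1` A.
have bA : borel_set (phi @^-1` A) by have := mphi measurableT A mA; rewrite setTI.
have mC : measurable C by exact: (re u _ bA).
have fC : P C \is a fin_num by exact: fin_num_measure.
pose c := NngNum (fine_ge0 (measure_ge0 P C)).
have key : forall D, <<s cylinders_off u >> D -> mrestr P mC D = mscale c P D.
  apply: (g_sigma_algebra_measure_unique (cylinders_off u) _ (fun=> setT)).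
  - exact: cylinders_off_measurable.
  - move=> _; exists [::], (fun=> setT); split => //.
    + by move=> _; exact: borel_setT.
    + by apply/seteqP; split => w // _ t /=; rewrite in_nil.
  - by rewrite bigcup_const//; exists 0%N.
  - exact: cylinders_off_setI.
  - move=> _ [s [B0 [us nus bB0 ->]]].
    (* As [u] is not in [s], a cylinder over [s] intersected with [C] is a cylinder over [u :: s],
       to which the independence hypothesis applies. *)
    pose B1 t := if t == u then phi @^-1` A else B0 t.
    have B1u : B1 u = phi @^-1` A by rewrite /B1 eqxx.
    have B1s t : t \in s -> B1 t = B0 t.
      by rewrite /B1 => ts; case: eqP => // tu; move: nus; rewrite -tu ts.
    have bB1 t : borel_set (B1 t) by rewrite /B1; case: ifP.
    have := ie (u :: s) B1; rewrite /= nus => /(_ us bB1).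
    have := ie s B0 us bB0.
    have -> : (\prod_(t <- s) P (e t @^-1` B0 t) = \prod_(t <- s) P (e t @^-1` B1 t))%E.
      by apply: eq_big_seq => t ts; rewrite B1s.
    rewrite big_cons B1u => <- h; rewrite /mrestr /mscale/= fineK// -[in RHS]/C -h.
    congr (P _); apply/seteqP; split => [w [hs hu] t /=|w h'].
      by rewrite inE => /orP[/eqP ->|ts]; rewrite ?B1u ?B1s//; exact: hs.
    split => [t /= ts|]; first by have := h' t; rewrite /= inE ts orbT B1s//; apply.
    by have := h' u; rewrite /= inE eqxx B1u; apply.
  - by move=> _; rewrite /= /mrestr -ge0_fin_numE ?measure_ge0// fin_num_measure//; exact: measurableI.
have := key (W @^-1` B); rewrite /mrestr /mscale/= fineK// setIC; apply.
by have := mW measurableT B mB; rewrite setTI.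
Qed.

Lemma E_mul_off (u : int) (phi : 'cV[R]_p -> R) (W : T -> R) :
  (forall t, random_vector (e t)) -> independent_vectors P e ->
  @measurable_fun _ _ Bor R setT phi -> @measurable_fun _ _ (off u) R setT W ->
  L1 P (fun w => phi (e u w)) -> L1 P W -> E (fun w => phi (e u w)) = 0 ->
  E (fun w => phi (e u w) * W w) = 0.
Proof.
move=> re ie mphi mW iphi iW E0.
have [_ ->] := E_mul_indep iphi iW (indep_off re ie mphi mW).
by rewrite E0 mul0r.
Qed.

End Noise.

Section WhiteNoise.
Context d (T : measurableType d) (R : realType) (P : probability T R) (p : nat).
Context (e : int -> T -> 'cV[R]_p) (he : white_gaussian_noise P e).
Local Notation E X := (Rintegral P setT X).
Local Notation x t a := (fun w => e t w a 0).
Local Notation Bor := (g_sigma_algebraType (@open 'cV[R]_p)).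
Local Notation off u := (g_sigma_algebraType (cylinders_off e u)).
Local Notation C4 := (8 * 58 * 8 ^+ 2 + 8 * 98 ^+ 2 : R).

Lemma noise_random_vector t : random_vector (e t).
Proof. by have [] := wgn_gaussian he t. Qed.

Lemma noise_measurable t a : measurable_fun setT (x t a).
Proof.
exact: (random_vector_comp (noise_random_vector t) (borel_measurable_coord a)).
Qed.

Lemma noise_covE t a b : (\int[P]_w (e t w a 0 * e t w b 0)%:E = ((a == b)%:R : R)%:E)%E.
Proof.
have := wgn_covariance he t a b; rewrite mxE => <-.
rewrite unlock !(wgn_mean he) /= unlock.
by apply: eq_integral => w _; rewrite /= [in RHS]/GRing.mul /= !subr0.
Qed.

Lemma noise_fourth t a : L1 P (fun w => e t w a 0 ^+ 4) /\
  E (fun w => e t w a 0 ^+ 4) <= C4.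
Proof.
have mX := noise_measurable t a.
have gX : gaussian_rv P (x t a).
  have [_ /(_ (delta_mx a 0))] := wgn_gaussian he t.
  rewrite (_ : (fun w => _) = x t a)//; apply/funext => w.
  rewrite mxE (bigD1 a)//= big1 ?addr0 => [|j ja]; last first.
    by rewrite !mxE (negbTE ja) mul0r.
  by rewrite !mxE !eqxx mul1r.
have h4 := gaussian_fourth_moment mX gX.
have X2 : (\int[P]_w (e t w a 0 ^+ 2)%:E = 1)%E.
  by have := noise_covE t a a; rewrite eqxx; under eq_integral do rewrite -expr2.
have {}h4 := h4 X2.
have i4 : L1 P (fun w => e t w a 0 ^+ 4).
  apply: L1_of_ge0_lty; [exact: measurable_funX|by move=> w; rewrite exprn_even_ge0|].
  exact: le_lt_trans h4 (ltry _).
by split => //; rewrite -lee_fin EFin_E.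
Qed.

(** The bound [(X Y)^2 <= X^4 + Y^4] uses no independence, so equal times are covered; this is what
    fourth moments are for. *)
Lemma noise_L2_mul t a s b : L2 P (fun w => e t w a 0 * e s w b 0).
Proof.
have mX := noise_measurable t a; have mY := noise_measurable s b.
split; first exact: measurable_funM.
apply: (@L1_le _ _ _ _ _ (fun w => e t w a 0 ^+ 4 + e s w b 0 ^+ 4)).
- by apply: measurable_funX; exact: measurable_funM.
- move=> w; rewrite ger0_norm ?sqr_ge0// exprMn.
  have := sqr_ge0 (e t w a 0 ^+ 2 - e s w b 0 ^+ 2).
  have := sqr_ge0 (e t w a 0 ^+ 2); have := sqr_ge0 (e s w b 0 ^+ 2); lra.
- by apply: L1_add; [exact: (noise_fourth t a).1|exact: (noise_fourth s b).1].
Qed.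

Lemma noise_sqr_mul_le t a s b : E (fun w => (e t w a 0 * e s w b 0) ^+ 2) <= C4.
Proof.
have [i4 l4] := noise_fourth t a; have [j4 k4] := noise_fourth s b.
apply: (@le_trans _ _ (E (fun w => 2^-1 * (e t w a 0 ^+ 4 + e s w b 0 ^+ 4)))).
  apply: le_Rintegral => //.
  - by case: (noise_L2_mul t a s b).
  - by apply: L1_scale; exact: L1_add.
  move=> w _; rewrite exprMn.
  have := sqr_ge0 (e t w a 0 ^+ 2 - e s w b 0 ^+ 2); lra.
rewrite RintegralZl//; last exact: L1_add.
by rewrite RintegralD//; lra.
Qed.

Lemma noise_L2 t a : L2 P (x t a).
Proof.
split; first exact: noise_measurable.
under eq_fun do rewrite expr2; exact/L2_L1/noise_L2_mul.
Qed.

Lemma noise_mean t a : E (x t a) = 0.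
Proof.
by have := wgn_mean he t a; rewrite unlock /Rintegral => ->.
Qed.

Lemma noise_E_mul_off u a (W : T -> R) : @measurable_fun _ _ (off u) R setT W ->
  L1 P W -> E (fun w => e u w a 0 * W w) = 0.
Proof.
move=> mW iW; apply: (E_mul_off (phi := fun v => v a 0)) mW _ iW _.
- exact: noise_random_vector.
- exact: wgn_independent.
- exact: borel_measurable_coord.
- exact/L2_L1/noise_L2.
- exact: noise_mean.
Qed.

Lemma noise_cov t s a b :
  E (fun w => e t w a 0 * e s w b 0) = ((t == s) && (a == b))%:R.
Proof.
have [->|ts] := eqVneq t s; first by rewrite /Rintegral noise_covE.
apply: noise_E_mul_off; last exact/L2_L1/noise_L2.
by apply: off_measurable_coord; rewrite eq_sym.
Qed.

(** The subtracted indicator is the expectation of the product, by [noise_cov]. *)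
Definition noise_product (h : int) (a b : 'I_p) (t : int) (w : T) : R :=
  e (t + h) w a 0 * e t w b 0 - ((h == 0) && (a == b))%:R.

Lemma noise_product_L2 h a b t : L2 P (noise_product h a b t).
Proof. by apply: L2_sub; [exact: noise_L2_mul|exact: L2_cst]. Qed.

Lemma noise_products_orthogonal (h t s : int) a b : t != s ->
  E (fun w => noise_product h a b t w * noise_product h a b s w) = 0.
Proof.
set Z := noise_product h a b => ts.
have Z2 r : L2 P (Z r) by exact: noise_product_L2.
(* At [h = 0] the whole centred product is one function of [e t], so it is treated as a single
   factor of mean 0 independent of [Z s]. *)
have [h0|h0] := eqVneq h 0.
  have ZE : Z t = (fun w => (e t w a 0 * e t w b 0 - ((h == 0) && (a == b))%:R)).
    by apply/funext => w; rewrite /Z /noise_product h0 addr0.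
  rewrite ZE.
  apply: (E_mul_off (phi := fun v => v a 0 * v b 0 - ((h == 0) && (a == b))%:R)).
  - exact: noise_random_vector.
  - exact: (wgn_independent he).
  - by apply: measurable_funB => //; apply: measurable_funM; exact: borel_measurable_coord.
  - rewrite /Z /noise_product h0 addr0; apply: measurable_funB => //.
    by apply: measurable_funM; apply: off_measurable_coord; rewrite eq_sym.
  - by rewrite -ZE; exact: L2_L1.
  - exact: L2_L1.
  - rewrite RintegralB//; [|exact/L2_L1/noise_L2_mul|exact: L1_cst].
    by rewrite E_cst noise_cov h0 eqxx subrr.
have ZE r w : Z r w = e (r + h) w a 0 * e r w b 0 by rewrite /Z /noise_product (negbTE h0) subr0.
(* Of the times [t + h], [t], [s + h], [s], the one occurring once is [t + h = s + 2h] if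
   [t = s + h], and [t] otherwise. *)
have [tsh|tsh] := eqVneq t (s + h).
  have -> : (fun w => Z t w * Z s w) =
      (fun w => e (t + h) w a 0 * (e t w b 0 * (e (s + h) w a 0 * e s w b 0))).
    by apply/funext => w; rewrite !ZE; ring.
  apply: noise_E_mul_off; last by apply: L2_L1_mul; [exact: noise_L2|exact: noise_L2_mul].
  apply: measurable_funM; first by apply: off_measurable_coord; lia.
  by apply: measurable_funM; apply: off_measurable_coord; lia.
have -> : (fun w => Z t w * Z s w) =
    (fun w => e t w b 0 * (e (t + h) w a 0 * (e (s + h) w a 0 * e s w b 0))).
  by apply/funext => w; rewrite !ZE; ring.
apply: noise_E_mul_off; last by apply: L2_L1_mul; [exact: noise_L2|exact: noise_L2_mul].
apply: measurable_funM; first by apply: off_measurable_coord; lia.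
by apply: measurable_funM; apply: off_measurable_coord; lia.
Qed.

Lemma noise_products_sum (h : int) a b (r : seq int) : uniq r ->
  E (fun w => (\sum_(t <- r) noise_product h a b t w) ^+ 2) <= (size r)%:R * (2 * C4 + 2).
Proof.
set Z := noise_product h a b => ur; apply: E_sqr_sum_orthogonal => //.
- exact: noise_product_L2.
- by move=> t s ts; exact: noise_products_orthogonal.
move=> t; set c : R := ((h == 0) && (a == b))%:R.
have c1 : 0 <= c <= 1 by rewrite /c ler0n lern1 leq_b1.
have [_ i2] := noise_L2_mul (t + h) a t b.
apply: (@le_trans _ _ (E (fun w => 2 * (e (t + h) w a 0 * e t w b 0) ^+ 2 + 2))).
  apply: le_Rintegral => //.
  - by have [] := noise_product_L2 h a b t.
  - by apply: L1_add; [exact: L1_scale|exact: L1_cst].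
  - move=> w _; rewrite /Z /noise_product -/c; set y := e _ _ _ _ * _.
    have := sqr_ge0 (y + c); have : c ^+ 2 <= 1 by rewrite expr_le1; case/andP: c1.
    lra.
rewrite RintegralD//; [|exact: L1_scale|exact: L1_cst].
by rewrite RintegralZl// E_cst lerD2r ler_wpM2l// noise_sqr_mul_le.
Qed.

End WhiteNoise.

(** * Mean-square limits *)

Lemma cvgr_sum (R : realType) (I : Type) (r : seq I) (u : I -> nat -> R) (l : I -> R) :
  (forall i, u i n @[n --> \oo] --> l i) ->
  (\sum_(i <- r) u i n) @[n --> \oo] --> \sum_(i <- r) l i.
Proof.
move=> ul; elim: r => [|i r ih].
  by rewrite big_nil; under eq_fun do rewrite big_nil; exact: cvg_cst.
by rewrite big_cons; under eq_fun do rewrite big_cons; exact: cvgD.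
Qed.

(** Cauchy-Schwarz with weights [|c i|]. With random [z] it reduces the second moment of a sum to
    those of its terms, with no information on their correlation. *)
Lemma sqr_sum_le (R : realFieldType) (I : Type) (r : seq I) (c z : I -> R) :
  (\sum_(i <- r) c i * z i) ^+ 2 <=
  (\sum_(i <- r) `|c i|) * \sum_(i <- r) `|c i| * z i ^+ 2.
Proof.
elim: r => [|i r ih]; first by rewrite !big_nil expr0n mulr0.
rewrite !big_cons.
have := @sumr_ge0 R I r xpredT (fun j => `|c j|) (fun j _ => normr_ge0 (c j)).
have : 0 <= \sum_(j <- r) `|c j| * z j ^+ 2.
  by apply: sumr_ge0 => j _; rewrite mulr_ge0 ?sqr_ge0.
move: ih; set S := \sum_(j <- r) _; set A := \sum_(j <- r) _; set B := \sum_(j <- r) _.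
move=> h B0 A0; rewrite sqrrD.
have ci : `|c i| ^+ 2 = c i ^+ 2 by rewrite real_normK// num_real.
have ci0 : 0 <= `|c i| by [].
rewrite [leRHS](_ : _ = (c i * z i) ^+ 2 + `|c i| * (B + A * z i ^+ 2) + A * B); last first.
  by rewrite exprMn -ci; ring.
rewrite lerD// lerD2l.
(* The cross term: by induction [S^2 <= A B], so the square of the left side is at most
   [4 B (A z^2)], hence at most [(B + A z^2)^2]. *)
have h2 : 2 * (`|S| * `|z i|) <= B + A * z i ^+ 2.
  have Az : 0 <= A * z i ^+ 2 by rewrite mulr_ge0 ?sqr_ge0.
  rewrite -(@ler_pXn2r _ 2)// ?nnegrE ?mulr_ge0 ?addr_ge0//.
  have -> : (2 * (`|S| * `|z i|)) ^+ 2 = 4 * (S ^+ 2 * z i ^+ 2).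
    by rewrite !exprMn !real_normK ?num_real//; ring.
  have : S ^+ 2 * z i ^+ 2 <= A * B * z i ^+ 2 by rewrite ler_wpM2r ?sqr_ge0.
  by have := sqr_ge0 (B - A * z i ^+ 2); lra.
have : c i * z i * S <= `|c i| * (`|z i| * `|S|) by rewrite mulrA -!normrM ler_norm.
have := ler_wpM2l ci0 h2; lra.
Qed.

Section MeanSquareLimits.
Context d (T : measurableType d) (R : realType) (P : probability T R).
Local Notation E X := (Rintegral P setT X).
Implicit Types X Y S : T -> R.

(* [min(|S|, n)^2] is [2n]-Lipschitz in [S], hence continuous for L1 convergence. *)
Lemma E_sqr_le_L1_lim (S : T -> R) (S_ : nat -> T -> R) (B : R) :
  measurable_fun setT S -> (forall n, L2 P (S_ n)) -> (forall n, L1 P (fun w => S w - S_ n w)) ->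
  (forall n, E (fun w => S_ n w ^+ 2) <= B) ->
  E (fun w => `|S w - S_ n w|) @[n --> \oo] --> (0 : R) ->
  L2 P S /\ E (fun w => S w ^+ 2) <= B.
Proof.
move=> mS S2 SS SB S0.
pose phi (n : nat) w : R := Num.min `|S w| n%:R ^+ 2.
have mphi n : measurable_fun setT (phi n).
  by apply: measurable_funX; apply: measurable_minr => //; exact: measurableT_comp.
have m0 n w : 0 <= Num.min `|S w| n%:R by rewrite le_min normr_ge0 ler0n.
have iphi n : L1 P (phi n).
  apply: (@L1_le _ _ _ _ _ (fun=> n%:R ^+ 2)) => //; last exact: L1_cst.
  by move=> w; rewrite ger0_norm ?sqr_ge0// lerXn2r ?nnegrE// ge_min lexx orbT.
have phiB n : E (phi n) <= B.
  apply/ler_addgt0Pr => eps eps0.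
  (* The level [n] is fixed before [K], so the Lipschitz constant [2n] can be absorbed; the [+ 1]
     covers [n = 0]. *)
  have e1 : 0 < eps / (2 * n%:R + 1) by rewrite divr_gt0// ltr_wpDl// mulr_ge0.
  have /cvgr0Pnorm_le/(_ _ e1) [K _ /(_ K (leqnn K)) /= hK] := S0.
  have i1 : L1 P (fun w => S_ K w ^+ 2) by case: (S2 K).
  have i2 := L1_norm (SS K).
  apply: (@le_trans _ _ (E (fun w => S_ K w ^+ 2 + (2 * n%:R) * `|S w - S_ K w|))).
    apply: le_Rintegral => //; [exact: iphi|by apply: L1_add => //; exact: L1_scale|].
    move=> w _; rewrite /phi.
    have := m0 n w; have : Num.min `|S w| n%:R <= n%:R by rewrite ge_min lexx orbT.
    have : Num.min `|S w| n%:R <= `|S w| by rewrite ge_min lexx.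
    set q := Num.min _ _ => q1 q2 q0.
    have := lerB_dist (S w) (S_ K w).
    have -> : S_ K w ^+ 2 = `|S_ K w| ^+ 2 by rewrite real_normK// num_real.
    have := normr_ge0 (S w - S_ K w); have := normr_ge0 (S_ K w).
    set D := `|S w - _|; set s := `|S_ K w|; set t := `|S w| in q1 *.
    move=> s0 D0 st.
    (* If [s < q], then [q^2 - s^2 = (q - s)(q + s) <= 2n D], since [s < q <= n] and
       [q - s <= t - s <= D]. *)
    have [qs|sq] := leP q s.
      by rewrite (le_trans (_ : _ <= s ^+ 2))// ?lerXn2r ?nnegrE// lerDl mulr_ge0// mulr_ge0.
    nra.
  rewrite RintegralD//; last exact: L1_scale.
  rewrite RintegralZl// lerD//.
  rewrite ger0_norm in hK; last exact: Rintegral_ge0.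
  rewrite (le_trans (ler_wpM2l _ hK)) ?mulr_ge0// mulrCA ler_piMr//; first exact: ltW.
  by rewrite ler_pdivrMr ?mul1r ?lerDl// ltr_wpDl// mulr_ge0.
(* Integrability of [S^2] is not known beforehand: monotone convergence transfers the bound in the
   extended reals and yields it. *)
have mono : (\int[P]_w (phi n w)%:E)%E @[n --> \oo] --> (\int[P]_w (S w ^+ 2)%:E)%E.
  have -> : (\int[P]_w (S w ^+ 2)%:E = \int[P]_w (limn (fun n => (phi n w)%:E)))%E.
    apply: eq_integral => w _; apply/esym/cvg_lim => //.
    apply: cvg_near_cst; near=> n; congr EFin; rewrite /phi min_l ?real_normK ?num_real//.
    by near: n; exact: nbhs_infty_ger.
  apply: (@cvg_monotone_convergence _ _ _ _ _ _ (fun n w => (phi n w)%:E)) => //.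
  - by move=> n; exact/measurable_EFinP.
  - by move=> n w _; rewrite lee_fin sqr_ge0.
  - move=> w _ n m nm; rewrite lee_fin lerXn2r ?nnegrE//.
    by rewrite le_min ge_min lexx/= ge_min (ler_nat _ n m) nm orbT.
have SB' : (\int[P]_w (S w ^+ 2)%:E <= B%:E)%E.
  by apply: (cvge_le _ mono); near=> n; rewrite -EFin_E// lee_fin.
have S2' : L1 P (fun w => S w ^+ 2).
  apply: L1_of_ge0_lty; [exact: measurable_funX|by move=> w; exact: sqr_ge0|].
  exact: le_lt_trans SB' (ltry _).
by split=> //; rewrite -lee_fin EFin_E.
Unshelve. all: by end_near. Qed.

(** With [D = X - X_n] and [D' = Y - Y_n], the difference of products is [X D' + D Y - D D']. A
    pointwise Young inequality with parameter [h] takes the place of Cauchy-Schwarz for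
    integrals. *)
Lemma L1_cvg_mul X Y (X_ Y_ : nat -> T -> R) :
  L2 P X -> L2 P Y -> (forall n, L2 P (X_ n)) -> (forall n, L2 P (Y_ n)) ->
  E (fun w => (X w - X_ n w) ^+ 2) @[n --> \oo] --> (0 : R) ->
  E (fun w => (Y w - Y_ n w) ^+ 2) @[n --> \oo] --> (0 : R) ->
  E (fun w => `|X w * Y w - X_ n w * Y_ n w|) @[n --> \oo] --> (0 : R).
Proof.
move=> X2 Y2 X_2 Y_2 Xc Yc; apply/cvgr0Pnorm_le => eps eps0.
pose a := E (fun w => X w ^+ 2); pose b := E (fun w => Y w ^+ 2).
have a0 : 0 <= a by apply: Rintegral_ge0 => w _; exact: sqr_ge0.
have b0 : 0 <= b by apply: Rintegral_ge0 => w _; exact: sqr_ge0.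
have ab0 : 0 < 2 + a + b by lra.
pose h := Num.min 1 (eps / (2 + a + b)).
have h0 : 0 < h by rewrite lt_min ltr01/= divr_gt0.
have h1 : h <= 1 by rewrite ge_min lexx.
have h2 : h * (2 + a + b) <= eps by rewrite -ler_pdivlMr// ge_min lexx orbT.
have hh0 : 0 < h ^+ 2 by rewrite exprn_gt0.
have /cvgr0Pnorm_le/(_ _ hh0) NX := Xc.
have /cvgr0Pnorm_le/(_ _ hh0) NY := Yc.
near=> n.
have ED : E (fun w => (X w - X_ n w) ^+ 2) <= h ^+ 2.
  rewrite -[leLHS]ger0_norm; last by apply: Rintegral_ge0 => w _; exact: sqr_ge0.
  by near: n; exact: NX.
have ED' : E (fun w => (Y w - Y_ n w) ^+ 2) <= h ^+ 2.
  rewrite -[leLHS]ger0_norm; last by apply: Rintegral_ge0 => w _; exact: sqr_ge0.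
  by near: n; exact: NY.
pose D w := X w - X_ n w; pose D' w := Y w - Y_ n w.
have D2 : L2 P D by exact: L2_sub.
have D'2 : L2 P D' by exact: L2_sub.
rewrite ger0_norm; last exact: Rintegral_ge0.
(* [k] collects [h^-1 / 2] from the Young bound of [X D'] and [D Y], and [1 / 2] from [D D']. The
   expectation is then at most [h + h^2 + h (a + b) / 2], hence at most [h (2 + a + b) <= eps] as
   [h <= 1]. *)
pose k := (h^-1 + 1) / 2; have k0 : 0 <= k by rewrite divr_ge0// addr_ge0// invr_ge0 ltW.
have i1 : L1 P (fun w => D w ^+ 2) by case: D2.
have i2 : L1 P (fun w => D' w ^+ 2) by case: D'2.
have i3 : L1 P (fun w => X w ^+ 2) by case: X2.
have i4 : L1 P (fun w => Y w ^+ 2) by case: Y2.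
apply: (@le_trans _ _ (E (fun w => k * (D w ^+ 2 + D' w ^+ 2) + h / 2 * (X w ^+ 2 + Y w ^+ 2)))).
  apply: le_Rintegral => //.
  - by apply: L1_norm; apply: L1_sub; exact: L2_L1_mul.
  - by apply: L1_add; apply: L1_scale; exact: L1_add.
  move=> w _.
  have -> : X w * Y w - X_ n w * Y_ n w = X w * D' w + D w * Y w - D w * D' w.
    by rewrite /D /D'; ring.
  have hu u v : `|u * v| <= h / 2 * u ^+ 2 + h^-1 / 2 * v ^+ 2.
    have hv : h^-1 / 2 * v ^+ 2 = h / 2 * (v / h) ^+ 2 by field; rewrite gt_eqF.
    have -> : u * v = h * (u * (v / h)) by field; rewrite gt_eqF.
    rewrite hv normrM (gtr0_norm h0) -mulrDr [h / 2]mulrC -mulrA [leRHS]mulrCA.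
    rewrite ler_wpM2l ?(ltW h0)//.
    rewrite ler_norml; apply/andP; split.
      by have := sqr_ge0 (u + v / h); lra.
    by have := sqr_ge0 (u - v / h); lra.
  have h3 : `|D w * D' w| <= (D w ^+ 2 + D' w ^+ 2) / 2.
    rewrite ler_norml; apply/andP; split.
      by have := sqr_ge0 (D w + D' w); lra.
    by have := sqr_ge0 (D w - D' w); lra.
  have := hu (X w) (D' w); have := hu (Y w) (D w); rewrite (mulrC (Y w)).
  have := ler_normB (X w * D' w + D w * Y w) (D w * D' w).
  have := ler_normD (X w * D' w) (D w * Y w).
  rewrite /k; lra.
rewrite RintegralD//; [|by apply: L1_scale; exact: L1_add|by apply: L1_scale; exact: L1_add].
rewrite !RintegralZl//; [|exact: L1_add|exact: L1_add].
rewrite !RintegralD// -/a -/b.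
have kh : k * (h ^+ 2 + h ^+ 2) = h + h ^+ 2 by rewrite /k; field; rewrite gt_eqF.
have hh : h ^+ 2 <= h by rewrite expr2 ler_piMl// ltW.
have : k * (E (fun w => D w ^+ 2) + E (fun w => D' w ^+ 2)) <= k * (h ^+ 2 + h ^+ 2).
  by rewrite ler_wpM2l// lerD.
have : h * 0 <= h * (a + b) by apply: ler_wpM2l; [exact: ltW|exact: addr_ge0].
lra.
Unshelve. all: by end_near. Qed.

End MeanSquareLimits.

(** * Linear processes *)

Lemma normr_le_frob (R : realType) m n (A : 'M[R]_(m, n)) i j : `|A i j| <= frob A.
Proof.
rewrite /frob -[leLHS]ger0_norm// -sqrtr_sqr ler_wsqrtr//.
rewrite (bigD1 i)//= (bigD1 j)//= -addrA lerDl addr_ge0//.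
  by apply: sumr_ge0 => k _; exact: sqr_ge0.
by apply: sumr_ge0 => k _; apply: sumr_ge0 => l _; exact: sqr_ge0.
Qed.

Lemma frob_sqr (R : realType) m n (A : 'M[R]_(m, n)) :
  frob A ^+ 2 = \sum_i \sum_j `|A i j| ^+ 2.
Proof.
rewrite sqr_sqrtr//.
by apply: sumr_ge0 => k _; apply: sumr_ge0 => l _; exact: sqr_ge0.
Qed.

Section LinearProcess.
Context d (T : measurableType d) (R : realType) (P : probability T R) (m p : nat).
Context (M : int -> 'M[R]_(m, p)) (e : int -> T -> 'cV[R]_p) (y : int -> T -> 'cV[R]_m).
Hypotheses (hM1 : cvgn (series (fun s : nat => frob (M s%:Z))))
  (he : white_gaussian_noise P e) (hy : linear_process P M e y).
Local Notation E X := (Rintegral P setT X).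
Local Notation B0 := (2 * (8 * 58 * 8 ^+ 2 + 8 * 98 ^+ 2) + 2 : R).

(** Each of the [p] entries in a row of [M s] is at most the Frobenius norm, so [gain] bounds the l1
    norm of the coefficients of every coordinate of [y]. *)
Definition gain : R := p%:R * limn (series (fun s : nat => frob (M s%:Z))).

Definition truncation K (t : int) (i : 'I_m) (w : T) : R :=
  \sum_(q : 'I_K * 'I_p) M (q.1 : nat)%:Z i q.2 * e (t - (q.1 : nat)%:Z) w q.2 0.

Lemma truncationE K t i w :
  (\sum_(0 <= s < K) M s%:Z *m e (t - s%:Z) w) i 0 = truncation K t i w.
Proof.
rewrite summxE big_mkord /truncation.
rewrite -(pair_big xpredT xpredT (fun (s : 'I_K) a => M s%:Z i a * e (t - s%:Z) w a 0))/=.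
by apply: eq_bigr => s _; rewrite mxE.
Qed.

Lemma gain_ge0 : 0 <= gain.
Proof.
rewrite mulr_ge0// limr_ge//; near=> n.
by apply: sumr_ge0 => s _; exact: sqrtr_ge0.
Unshelve. all: by end_near. Qed.

Lemma sum_coef_le K i : \sum_(q : 'I_K * 'I_p) `|M (q.1 : nat)%:Z i q.2| <= gain.
Proof.
rewrite -(pair_big xpredT xpredT (fun (s : 'I_K) a => `|M (s : nat)%:Z i a|))/=.
apply: (@le_trans _ _ (\sum_(s < K) p%:R * frob (M (s : nat)%:Z))).
  apply: ler_sum => s _.
  rewrite (le_trans (ler_sum _ (fun a _ => normr_le_frob _ i a)))//.
  by rewrite sumr_const card_ord mulr_natl.
rewrite -mulr_sumr ler_wpM2l//.
rewrite -(big_mkord xpredT (fun s => frob (M s%:Z))).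
apply: nondecreasing_cvgn_le => //.
by apply: nondecreasing_series => s _ _; exact: sqrtr_ge0.
Qed.

Lemma truncation_L2 K t i : L2 P (truncation K t i).
Proof. by apply: L2_sum => q; apply: L2_scale; exact: noise_L2. Qed.

Local Notation idx K := (('I_K * 'I_p) * ('I_K * 'I_p))%type.

Definition coef2 K i j (z : idx K) : R :=
  M (z.1.1 : nat)%:Z i z.1.2 * M (z.2.1 : nat)%:Z j z.2.2.

(** The noises multiplied in the term [z] of [y(t + k) y(t)] have times [t + k - s] and [t - s'];
    this is their difference. *)
Definition lag2 K (k : int) (z : idx K) : int := k - (z.1.1 : nat)%:Z + (z.2.1 : nat)%:Z.

Definition truncated_cov K (k : int) i j : R :=
  \sum_(z : idx K) coef2 i j z * ((lag2 k z == 0) && (z.1.2 == z.2.2))%:R.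

Lemma sum_coef2_le K i j : \sum_(z : idx K) `|coef2 i j z| <= gain ^+ 2.
Proof.
rewrite (eq_bigr (fun z : idx K => `|M (z.1.1 : nat)%:Z i z.1.2| * `|M (z.2.1 : nat)%:Z j z.2.2|)); last first.
  by move=> z _; rewrite normrM.
rewrite -(pair_big xpredT xpredT (fun q q' : 'I_K * 'I_p =>
  `|M (q.1 : nat)%:Z i q.2| * `|M (q'.1 : nat)%:Z j q'.2|))/=.
rewrite -big_distrlr/= expr2 ler_pM ?sum_coef_le//; exact: sumr_ge0.
Qed.

(** For a given [z] only the lag [s - s'] makes [lag2 k z] vanish, so a list of distinct lags meets
    each coefficient at most once. In the limit this gives absolute summability of the
    covariances. *)
Lemma sum_truncated_cov_le K i j (r : seq int) : uniq r ->
  \sum_(k <- r) `|truncated_cov K k i j| <= gain ^+ 2.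
Proof.
move=> ur; apply: le_trans (sum_coef2_le K i j).
apply: (@le_trans _ _ (\sum_(k <- r) \sum_(z : idx K) `|coef2 i j z| * (lag2 k z == 0)%:R)).
  apply: ler_sum => k _; apply: le_trans (ler_norm_sum _ _ _) _.
  apply: ler_sum => z _; rewrite normrM ler_wpM2l// normr_nat ler_nat.
  by case: (lag2 k z == 0); case: (_ == _).
rewrite exchange_big/=; apply: ler_sum => z _.
rewrite -mulr_sumr -[leRHS]mulr1 ler_wpM2l//.
rewrite -natr_sum lern1.
rewrite (_ : (\sum_(k <- r) _)%N = count_mem ((z.1.1 : nat)%:Z - (z.2.1 : nat)%:Z) r).
  by rewrite count_uniq_mem// leq_b1.
rewrite -sum1_count [RHS]big_mkcond/=; apply: eq_bigr => k _.
have -> : (lag2 k z == 0) = (k == (z.1.1 : nat)%:Z - (z.2.1 : nat)%:Z) by rewrite /lag2; lia.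
by case: (_ == _).
Qed.

Lemma truncation_mul K t k i j w :
  truncation K (t + k) i w * truncation K t j w - truncated_cov K k i j =
  \sum_(z : idx K) coef2 i j z *
     noise_product e (lag2 k z) z.1.2 z.2.2 (t - (z.2.1 : nat)%:Z) w.
Proof.
rewrite /truncation big_distrlr/= pair_big/= /truncated_cov -sumrB.
apply: eq_bigr => z _; rewrite /coef2 /noise_product /lag2 mulrBr mulrACA.
by congr (_ * (e _ _ _ _ * _) - _); ring.
Qed.

Lemma noise_product_mean h a b t : E (noise_product e h a b t) = 0.
Proof.
rewrite RintegralB//; [|exact/L2_L1/noise_L2_mul|exact: L1_cst].
rewrite E_cst (noise_cov he).
have -> : (t + h == t) = (h == 0) by rewrite -[X in _ == X]addr0 (inj_eq (addrI t)).
by rewrite subrr.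
Qed.

Lemma E_truncation_mul K t k i j :
  E (fun w => truncation K (t + k) i w * truncation K t j w) = truncated_cov K k i j.
Proof.
apply/eqP; rewrite -subr_eq0 -[X in _ - X](E_cst P) -RintegralB//; last 2 first.
- by apply: L2_L1_mul; exact: truncation_L2.
- exact: L1_cst.
under eq_Rintegral do rewrite truncation_mul.
have np z : L1 P (noise_product e (lag2 k z) z.1.2 z.2.2 (t - ((z : idx K).2.1 : nat)%:Z)).
  exact/L2_L1/noise_product_L2.
rewrite E_sum; last by move=> z; exact: L1_scale.
rewrite big1// => z _; rewrite RintegralZl; [|by []|exact: np].
by rewrite noise_product_mean mulr0.
Qed.

(** Summing over [t] first, orthogonality bounds each [z] by [size r] times a constant; the weighted
    Cauchy-Schwarz inequality over [z] then contributes the sum of [|coef2|] twice, hence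
    [gain ^+ 4]. The bound is free of [K], as the passage to [y] requires. *)
Lemma E_sqr_sum_truncation_le K k i j (r : seq int) : uniq r ->
  E (fun w => (\sum_(t <- r)
     (truncation K (t + k) i w * truncation K t j w - truncated_cov K k i j)) ^+ 2)
  <= gain ^+ 4 * ((size r)%:R * B0).
Proof.
move=> ur.
pose Y (z : idx K) w := \sum_(t <- [seq t - (z.2.1 : nat)%:Z | t <- r])
  noise_product e (lag2 k z) z.1.2 z.2.2 t w.
have Y2 z : L2 P (Y z) by apply: L2_sum => t; exact: noise_product_L2.
have YB z : E (fun w => Y z w ^+ 2) <= (size r)%:R * B0.
  rewrite -(size_map (fun t => t - (z.2.1 : nat)%:Z) r).
  apply: (noise_products_sum he); rewrite map_inj_uniq//.
  exact: addIr.
have SE w : \sum_(t <- r)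
     (truncation K (t + k) i w * truncation K t j w - truncated_cov K k i j) =
   \sum_(z : idx K) coef2 i j z * Y z w.
  under eq_bigr do rewrite truncation_mul.
  by rewrite exchange_big/=; apply: eq_bigr => z _; rewrite -mulr_sumr /Y big_map.
under eq_Rintegral do rewrite SE.
have iY z : L1 P (fun w => `|coef2 i j z| * Y z w ^+ 2).
  by apply: L1_scale; case: (Y2 z).
apply: (@le_trans _ _ (E (fun w => (\sum_(z : idx K) `|coef2 i j z|) *
    \sum_(z : idx K) `|coef2 i j z| * Y z w ^+ 2))).
  apply: le_Rintegral => //.
  - have [] : L2 P (fun w => \sum_(z : idx K) coef2 i j z * Y z w).
      by apply: L2_sum => z; exact: L2_scale.
    by [].
  - by apply: L1_scale; exact: L1_sum.
  - by move=> w _; exact: sqr_sum_le.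
rewrite RintegralZl//; last exact: L1_sum.
rewrite E_sum//.
have s0 : 0 <= (size r)%:R * B0 by rewrite mulr_ge0//; lra.
apply: (@le_trans _ _ (gain ^+ 2 * (gain ^+ 2 * ((size r)%:R * B0)))); last first.
  by rewrite mulrA -exprD.
apply: ler_pM.
- exact: sumr_ge0.
- by apply: sumr_ge0 => z _; apply: Rintegral_ge0 => w _; rewrite mulr_ge0 ?sqr_ge0.
- exact: sum_coef2_le.
apply: (@le_trans _ _ (\sum_(z : idx K) `|coef2 i j z| * ((size r)%:R * B0))).
  apply: ler_sum => z _; rewrite RintegralZl//; last by case: (Y2 z).
  by rewrite ler_wpM2l.
by rewrite -mulr_suml ler_wpM2r// sum_coef2_le.
Qed.

Lemma process_measurable t i : measurable_fun setT (fun w => y t w i 0).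
Proof.
exact: (random_vector_comp (hy t).1 (borel_measurable_coord i)).
Qed.

Lemma truncation_error_le t i K :
  (\int[P]_w ((y t w i 0 - truncation K t i w) ^+ 2)%:E <=
   'E_P[fun w => (frob (y t w - \sum_(0 <= s < K) M s%:Z *m e (t - s%:Z) w) ^+ 2)%R])%E.
Proof.
rewrite unlock; under [leRHS]eq_integral do rewrite frob_sqr.
have mq j : measurable_fun setT (fun w => y t w j 0 - truncation K t j w).
  by apply: measurable_funB; [exact: process_measurable|case: (truncation_L2 K t j)].
have qE w (j : 'I_m) (l : 'I_1) :
    (y t w - \sum_(0 <= s < K) M s%:Z *m e (t - s%:Z) w) j l = y t w j 0 - truncation K t j w.
  by rewrite mxE [X in _ + X]mxE (ord1 l) truncationE.
apply: ge0_le_integral => //=.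
- by move=> w _; rewrite lee_fin sqr_ge0.
- by apply/measurable_EFinP; exact: measurable_funX.
- apply/measurable_EFinP; apply: measurable_sum => j; apply: measurable_sum => l.
  under eq_fun do rewrite qE; apply: measurable_funX; exact: measurableT_comp.
move=> w _; rewrite lee_fin (bigD1 i)//= big_ord1 qE real_normK ?num_real// lerDl.
by apply: sumr_ge0 => j _; apply: sumr_ge0 => l _; exact: sqr_ge0.
Qed.

(** Convergence to 0 in the extended reals makes the truncation error finite for some [K], and [y]
    is that error plus a square-integrable truncation. *)
Lemma process_L2 t i : L2 P (fun w => y t w i 0).
Proof.
have [_ /fine_cvgP[[K _ /(_ K (leqnn K)) /= fK] _]] := hy t.
have mq : measurable_fun setT (fun w => y t w i 0 - truncation K t i w).
  by apply: measurable_funB; [exact: process_measurable|case: (truncation_L2 K t i)].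
have dL : L2 P (fun w => y t w i 0 - truncation K t i w).
  split=> //; apply: L1_of_ge0_lty; first exact: measurable_funX.
    by move=> w; exact: sqr_ge0.
  by apply: le_lt_trans (truncation_error_le t i K) _; rewrite ltey_eq fK.
have := L2_add dL (truncation_L2 K t i).
by under eq_fun do rewrite subrK.
Qed.

Lemma truncation_cvg t i :
  E (fun w => (y t w i 0 - truncation K t i w) ^+ 2) @[K --> \oo] --> (0 : R).
Proof.
have [_ /fine_cvgP[fK cK]] := hy t.
apply: (squeeze_cvgr _ (cvg_cst (0 : R)) cK); near=> K.
have i2 : L1 P (fun w => (y t w i 0 - truncation K t i w) ^+ 2).
  by have [] := L2_sub (process_L2 t i) (truncation_L2 K t i).
apply/andP; split; first by apply: Rintegral_ge0 => w _; exact: sqr_ge0.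
rewrite -lee_fin EFin_E// fineK; first exact: truncation_error_le.
by near: K.
Unshelve. all: by end_near. Qed.

Lemma truncation_mul_cvg t s i j :
  E (fun w => `|y t w i 0 * y s w j 0 - truncation K t i w * truncation K s j w|)
    @[K --> \oo] --> (0 : R).
Proof.
apply: L1_cvg_mul; [exact: process_L2|exact: process_L2|..].
- by move=> n; exact: truncation_L2.
- by move=> n; exact: truncation_L2.
- exact: truncation_cvg.
- exact: truncation_cvg.
Qed.

Lemma truncated_cov_cvg t k i j :
  truncated_cov K k i j @[K --> \oo] --> E (fun w => y (t + k) w i 0 * y t w j 0).
Proof.
apply/cvgrPdist_le => eps eps0.
have /cvgr0Pnorm_le/(_ _ eps0) := truncation_mul_cvg (t + k) t i j.
apply: filterS => K; rewrite ger0_norm; last exact: Rintegral_ge0.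
apply: le_trans.
have i1 : L1 P (fun w => y (t + k) w i 0 * y t w j 0) by apply: L2_L1_mul; exact: process_L2.
have i2 : L1 P (fun w => truncation K (t + k) i w * truncation K t j w).
  by apply: L2_L1_mul; exact: truncation_L2.
rewrite -(E_truncation_mul K t) -RintegralB// le_normr_Rintegral//.
exact: L1_sub.
Qed.

Definition process_cov (k : int) i j : R := E (fun w => y k w i 0 * y 0 w j 0).

(** [truncated_cov] does not involve [t], and limits are unique. *)
Lemma process_cov_stationary t k i j :
  E (fun w => y (t + k) w i 0 * y t w j 0) = process_cov k i j.
Proof.
have h : truncated_cov K k i j @[K --> \oo] --> E (fun w => y (0 + k) w i 0 * y 0 w j 0).
  exact: truncated_cov_cvg.
rewrite add0r in h; apply: cvg_unique h => //.
exact: truncated_cov_cvg.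
Qed.

Lemma process_covN k i j : process_cov (- k) i j = process_cov k j i.
Proof.
rewrite -(process_cov_stationary k (- k)) addrN.
by rewrite -[RHS](process_cov_stationary 0 k) add0r; apply: eq_Rintegral => w _; rewrite mulrC.
Qed.

Lemma process_cov_cvg k i j : truncated_cov K k i j @[K --> \oo] --> process_cov k i j.
Proof. by rewrite -(process_cov_stationary 0); exact: truncated_cov_cvg. Qed.

Lemma sum_process_cov_le i j (r : seq int) : uniq r ->
  \sum_(k <- r) `|process_cov k i j| <= gain ^+ 2.
Proof.
move=> ur; have h : (\sum_(k <- r) `|truncated_cov K k i j|) @[K --> \oo] -->
    \sum_(k <- r) `|process_cov k i j|.
  by apply: cvgr_sum => k; apply: cvg_norm; exact: process_cov_cvg.
rewrite -(cvg_lim _ h)//; apply: limr_le; first exact: cvgP h.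
by near=> K; exact: sum_truncated_cov_le.
Unshelve. all: by end_near. Qed.

Lemma E_sqr_sum_process_le k i j (r : seq int) : uniq r ->
  let S w := \sum_(t <- r) (y (t + k) w i 0 * y t w j 0 - process_cov k i j) in
  L2 P S /\ E (fun w => S w ^+ 2) <= gain ^+ 4 * ((size r)%:R * B0).
Proof.
move=> ur S.
pose S_ K w := \sum_(t <- r)
  (truncation K (t + k) i w * truncation K t j w - truncated_cov K k i j).
have yy t : L1 P (fun w => y (t + k) w i 0 * y t w j 0).
  by apply: L2_L1_mul; exact: process_L2.
have tt K t : L1 P (fun w => truncation K (t + k) i w * truncation K t j w).
  by apply: L2_L1_mul; exact: truncation_L2.
have S1 : L1 P S by apply: L1_sum => t; apply: L1_sub => //; exact: L1_cst.
have S_2 K : L2 P (S_ K).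
  rewrite /S_; under eq_fun do under eq_bigr do rewrite truncation_mul.
  by apply: L2_sum => t; apply: L2_sum => z; apply: L2_scale; exact: noise_product_L2.
apply: (E_sqr_le_L1_lim (S_ := S_)) => //.
- exact: (L1_measurable S1).
- by move=> K; apply: L1_sub => //; exact: L2_L1.
- by move=> K; exact: E_sqr_sum_truncation_le.
(* [u] dominates the L1 distance between [S] and [S_ K] by the triangle inequality: one part for the
   products, one for the centring constants. *)
pose u K := \sum_(t <- r) (E (fun w => `|y (t + k) w i 0 * y t w j 0 -
    truncation K (t + k) i w * truncation K t j w|) + `|process_cov k i j - truncated_cov K k i j|).
have u0 : u K @[K --> \oo] --> (0 : R).
  have -> : 0 = \sum_(t <- r) (0 + `|process_cov k i j - process_cov k i j|) :> R.
    by rewrite big1// => t _; rewrite subrr normr0 addr0.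
  apply: cvgr_sum => t; apply: cvgD; first exact: truncation_mul_cvg.
  by apply: cvg_norm; apply: cvgB; [exact: cvg_cst|exact: process_cov_cvg].
apply: (squeeze_cvgr _ (cvg_cst (0 : R)) u0); near=> K.
apply/andP; split; first exact: Rintegral_ge0.
have iD t : L1 P (fun w => `|y (t + k) w i 0 * y t w j 0 -
    truncation K (t + k) i w * truncation K t j w|) by apply: L1_norm; exact: L1_sub.
have iDc t : L1 P (fun w => `|y (t + k) w i 0 * y t w j 0 -
    truncation K (t + k) i w * truncation K t j w| + `|process_cov k i j - truncated_cov K k i j|).
  by apply: L1_add => //; exact: L1_cst.
have -> : u K = E (fun w => \sum_(t <- r) (`|y (t + k) w i 0 * y t w j 0 -
    truncation K (t + k) i w * truncation K t j w| + `|process_cov k i j - truncated_cov K k i j|)).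
  rewrite E_sum//; apply: eq_bigr => t _.
  rewrite RintegralD//; [by rewrite E_cst|exact: iD|exact: L1_cst].
apply: le_Rintegral => //.
- by apply: L1_norm; apply: L1_sub => //; exact: L2_L1.
- exact: L1_sum.
move=> w _; rewrite /S /S_ -sumrB (le_trans (ler_norm_sum _ _ _))//.
apply: ler_sum => t _.
have hB (a b c' f : R) : `|a - b - (c' - f)| <= `|a - c'| + `|b - f|.
  by rewrite (_ : a - b - (c' - f) = a - c' - (b - f)) ?ler_normB//; ring.
exact: hB.
Unshelve. all: by end_near. Qed.

End LinearProcess.

(** * Symmetric sums and the estimation error *)

Section SymmetricSums.
Context (R : realType).
Implicit Types (F g r : int -> R).

Definition symsum F n : R := \sum_(l < (2 * n).+1) F ((l : nat)%:Z - n%:Z).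

Definition window n : seq int := [seq l%:Z - n%:Z | l <- iota 0 (2 * n).+1].

Lemma window_uniq n : uniq (window n).
Proof. by rewrite map_inj_uniq ?iota_uniq// => a b; lia. Qed.

Lemma mem_window n k : k \in window n -> (`|k| <= n)%N.
Proof. by move=> /mapP[l]; rewrite mem_iota => /andP[_ ln] ->; lia. Qed.

Lemma symsumE F n : symsum F n = \sum_(k <- window n) F k.
Proof.
by rewrite /symsum /window big_map -(big_mkord xpredT (fun l => F (l%:Z - n%:Z))) /index_iota subn0.
Qed.

Lemma symsumS F n : symsum F n.+1 = F (- n.+1%:Z) + symsum F n + F n.+1%:Z.
Proof.
rewrite /symsum (_ : (2 * n.+1).+1 = (2 * n).+3); last lia.
rewrite big_ord_recl big_ord_recr/= sub0r addrA; congr (_ + _ + F _); last first.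
  by rewrite /bump/=; lia.
by apply: eq_bigr => l _; congr F; rewrite /bump/=; lia.
Qed.

(* The sums of [|r| + g r] and of [|r| - g r] are both nondecreasing. *)
Lemma symsum_limit g r (C : R) n :
  (forall k, `|g k| <= 1) -> (forall k, symsum (fun l => `|r l|) k <= C) ->
  cvgn (symsum (fun l => g l * r l)) /\
  `|limn (symsum (fun l => g l * r l)) - symsum (fun l => g l * r l) n| <=
    limn (symsum (fun l => `|r l|)) - symsum (fun l => `|r l|) n.
Proof.
move=> g1 rC; set a := symsum (fun l => `|r l|); set G := symsum _.
have gr l : `|g l * r l| <= `|r l| by rewrite normrM ler_piMl.
have GA k : `|G k| <= a k.
  rewrite /G /a !symsumE (le_trans (ler_norm_sum _ _ _))//.
  exact: ler_sum.
have nd_a : nondecreasing_seq a.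
  apply/nondecreasing_seqP => k; rewrite /a symsumS.
  by have := normr_ge0 (r (- k.+1%:Z)); have := normr_ge0 (r k.+1%:Z); lra.
have nd_p : nondecreasing_seq (fun k => a k + G k).
  apply/nondecreasing_seqP => k; rewrite /a /G !symsumS.
  have := gr (- k.+1%:Z); have := gr k.+1%:Z; rewrite !ler_norml => /andP[? _] /andP[? _]; lra.
have nd_m : nondecreasing_seq (fun k => a k - G k).
  apply/nondecreasing_seqP => k; rewrite /a /G !symsumS.
  have := gr (- k.+1%:Z); have := gr k.+1%:Z; rewrite !ler_norml => /andP[_ ?] /andP[_ ?]; lra.
have ca : cvgn a by apply: nondecreasing_is_cvgn => //; exists C => _ [k _ <-]; exact: rC.
have cp : cvgn (fun k => a k + G k).
  apply: nondecreasing_is_cvgn => //; exists (C + C) => _ [k _ <-].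
  by have := rC k; have := GA k; rewrite ler_norml => /andP[_ ?]; rewrite -/a; lra.
have cG : cvgn G.
  have -> : G = (fun k => (a k + G k) - a k) by apply/funext => k; rewrite addrC addKr.
  exact: is_cvgB.
split=> //; rewrite ler_norml; apply/andP; split.
  have := nondecreasing_cvgn_le nd_p cp n.
  have -> : limn (fun k => a k + G k) = limn a + limn G by exact: limD.
  by lra.
have cm : cvgn (fun k => a k - G k) by exact: is_cvgB.
have := nondecreasing_cvgn_le nd_m cm n.
have -> : limn (fun k => a k - G k) = limn a - limn G by exact: limB.
by lra.
Qed.

End SymmetricSums.

(** * Real and imaginary parts of Fourier sums and their limits *)

Section Complex.
Context (R : realType).
Local Open Scope complex_scope.

Lemma sum_complex I (r : seq I) (a b : I -> R) :
  \sum_(i <- r) (a i +i* b i) = (\sum_(i <- r) a i) +i* (\sum_(i <- r) b i).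
Proof.
elim: r => [|i r ih]; first by rewrite !big_nil.
by rewrite !big_cons ih.
Qed.

Lemma fourier_sumE m (r : int -> 'M[R]_m) n theta i j :
  fourier_sum r n theta i j =
  symsum (fun k => cos (- (theta * k%:~R)) * r k i j) n +i*
  symsum (fun k => sin (- (theta * k%:~R)) * r k i j) n.
Proof.
rewrite /fourier_sum summxE /symsum -sum_complex.
apply: eq_bigr => l _; rewrite !mxE /expi/=.
by simpc.
Qed.

Lemma lim_complex (u v : nat -> R) : cvgn u -> cvgn v ->
  limn (fun n => (u n +i* v n : R[i]^o)) = limn u +i* limn v.
Proof.
move=> cu cv; apply: cvg_lim; first exact: norm_hausdorff.
apply/cvgrPdist_lt => eps eps0.
(* The order of [R[i]] compares only numbers with equal imaginary parts, so a positive [eps] is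
   real. *)
have eps_im : complex.Im eps = 0 by move: eps0; rewrite ltcE/= => /andP[/eqP ->].
have eps_re : 0 < complex.Re eps by move: eps0; rewrite ltcE/= => /andP[_ ->].
have e2 : 0 < complex.Re eps / 2 by rewrite divr_gt0.
have /cvgrPdist_lt/(_ _ e2) hu := cu.
have /cvgrPdist_lt/(_ _ e2) hv := cv.
near=> n.
have un : `|limn u - u n| < complex.Re eps / 2 by near: n.
have vn : `|limn v - v n| < complex.Re eps / 2 by near: n.
rewrite normc_def/= ltcE/= eps_im eqxx/=.
set a := limn u - u n in un *; set b := limn v - v n in vn *.
apply: (@le_lt_trans _ _ (`|a| + `|b|)); last by lra.
rewrite -[leRHS]ger0_norm ?addr_ge0// -sqrtr_sqr; apply: ler_wsqrtr.
have ha := real_normK (num_real a); have hb := real_normK (num_real b).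
have : 0 <= `|a| * `|b| by rewrite mulr_ge0.
lra.
Unshelve. all: by end_near. Qed.

End Complex.

(** * Mean square error of one entry, for general lag weights *)

Section Estimation.
Context d (T : measurableType d) (R : realType) (P : probability T R) (m p : nat).
Context (M : int -> 'M[R]_(m, p)) (e : int -> T -> 'cV[R]_p) (y : int -> T -> 'cV[R]_m).
Hypotheses (hM1 : cvgn (series (fun s : nat => frob (M s%:Z))))
  (he : white_gaussian_noise P e) (hy : linear_process P M e y).
Local Notation E X := (Rintegral P setT X).
Local Notation B0 := (2 * (8 * 58 * 8 ^+ 2 + 8 * 98 ^+ 2) + 2 : R).
Local Notation cov := (process_cov P y).
Local Notation gain := (gain M).

Lemma autocovE t k i j : autocov P y t k i j = cov k i j.
Proof.
rewrite mxE unlock -(process_cov_stationary he hy t); congr fine.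
by apply: eq_integral => w _; rewrite !mxE big_ord1 !mxE.
Qed.

Lemma lag_sumE N k w i j :
  lag_sum y N k w i j =
  \sum_(t <- [seq t%:Z | t <- index_iota 1 (N - k).+1]) y (t + k%:Z) w i 0 * y t w j 0.
Proof.
rewrite /lag_sum summxE big_map; apply: eq_bigr => t _.
by rewrite !mxE big_ord1 !mxE.
Qed.

Context (a : nat -> R) (N n : nat) (i j : 'I_m) (amax b : R).
Hypotheses (nN : (n < N)%N) (a0 : forall k, (k <= n)%N -> 0 <= a k <= amax)
  (ab : forall k, (k <= n)%N -> `|1 - (N - k)%:R * a k| <= b).

Local Notation scov w := (two_sided (fun k => a k *: lag_sum y N k w)).

(** Centred at the mean of the weighted estimate, not at the covariance itself, so that the bias
    stays a separate deterministic term. *)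
Definition deviation (k : int) w : R :=
  scov w k i j - (N - `|k|)%:R * a `|k|%N * cov k i j.

(** Square integrability is given for every lag because the lemmas on sums quantify over all
    indices; the bound needs the weight estimate at lags up to [n]. *)
Lemma scov_dev_nonneg (k : nat) i' j' :
  let D w := a k * lag_sum y N k w i' j' - (N - k)%:R * a k * cov k i' j' in
  L2 P D /\ ((k <= n)%N -> E (fun w => D w ^+ 2) <= amax ^+ 2 * (gain ^+ 4 * (N%:R * B0))).
Proof.
move=> D.
set r := [seq t%:Z | t <- index_iota 1 (N - k).+1].
have ur : uniq r by rewrite map_inj_uniq ?iota_uniq// => u v; lia.
have sr : size r = (N - k)%N by rewrite size_map size_iota subn1.
have [] := E_sqr_sum_process_le hM1 he hy k i' j' ur.
set S := fun w => _ => S2 SB.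
have DE : D = (fun w => a k * S w).
  apply/funext => w; rewrite /D lag_sumE /S -/r sumrB mulrBr.
  by rewrite big_const_seq count_predT iter_addr_0 sr -[cov _ _ _ *+ _]mulr_natl; ring.
rewrite DE; split=> [|kn]; first exact: L2_scale.
have /andP[ak0 ak1] := a0 kn.
under eq_Rintegral do rewrite exprMn.
rewrite RintegralZl//; last by case: S2.
apply: ler_pM; rewrite ?exprn_ge0//.
- by apply: Rintegral_ge0 => w _; exact: sqr_ge0.
- by rewrite lerXn2r ?nnegrE// (le_trans ak0).
rewrite (le_trans SB)// ler_wpM2l ?exprn_ge0 ?gain_ge0//.
apply: ler_wpM2r; first by lra.
by rewrite ler_nat sr leq_subr.
Qed.

Lemma deviation_le (k : int) : L2 P (deviation k) /\ ((`|k| <= n)%N ->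
  E (fun w => deviation k w ^+ 2) <= amax ^+ 2 * (gain ^+ 4 * (N%:R * B0))).
Proof.
case: k => k.
  have := scov_dev_nonneg k i j; congr (L2 P _ /\ (_ -> E _ <= _)).
    by apply/funext => w; rewrite /deviation !mxE.
  by apply/funext => w; rewrite /deviation !mxE.
(* [two_sided] transposes at negative lags, which swaps [i] and [j]; [process_covN] does the same
   for the covariance. *)
have := scov_dev_nonneg k.+1 j i; congr (L2 P _ /\ (_ -> E _ <= _)).
  by apply/funext => w; rewrite /deviation !mxE NegzE (process_covN he hy).
by apply/funext => w; rewrite /deviation !mxE NegzE (process_covN he hy).
Qed.

Local Notation tail := (limn (symsum (fun l => `|cov l i j|)) - symsum (fun l => `|cov l i j|) n).

(** The error is [x + u - z]: series tail, bias, random deviation. Only [|g k| <= 1] is used, whence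
    the uniformity in the frequency. *)
Lemma E_component_le (g : int -> R) : (forall k, `|g k| <= 1) ->
  let D w := limn (symsum (fun k => g k * cov k i j)) -
             symsum (fun k => g k * scov w k i j) n in
  L2 P D /\ (E (fun w => D w ^+ 2) <= 3 * (tail ^+ 2 + b ^+ 2 * gain ^+ 4 +
    (2 * n).+1%:R ^+ 2 * (amax ^+ 2 * (gain ^+ 4 * (N%:R * B0)))))%R.
Proof.
move=> g1 D.
have covC q : symsum (fun l => `|cov l i j|) q <= gain ^+ 2.
  by rewrite symsumE; apply: (sum_process_cov_le hM1 he hy); exact: window_uniq.
have [_] := symsum_limit n g1 covC; set L := limn (symsum (fun l => g l * cov l i j)) => Lt.
pose x := L - symsum (fun l => g l * cov l i j) n.
pose u := \sum_(k <- window n) g k * ((1 - (N - `|k|)%:R * a `|k|%N) * cov k i j).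
pose z w := \sum_(k <- window n) g k * deviation k w.
have DE w : D w = x + u - z w.
  rewrite /D (_ : symsum _ n = symsum (fun l => g l * cov l i j) n - u + z w).
    by rewrite /x /L; ring.
  rewrite !symsumE /u /z -sumrB -big_split/=; apply: eq_bigr => k _.
  by rewrite /deviation; ring.
have z2 : L2 P z by apply: L2_sum => k; apply: L2_scale; exact: (deviation_le k).1.
have D2 : L2 P D.
  rewrite (_ : D = fun w => x + u - z w); last exact/funext.
  by apply: L2_sub => //; exact: L2_cst.
split=> //.
have dev2 k : L1 P (fun w => deviation k w ^+ 2) by have [[]] := deviation_le k.
have size_window : size (window n) = (2 * n).+1 by rewrite size_map size_iota.
have zB w : z w ^+ 2 <= (2 * n).+1%:R * \sum_(k <- window n) deviation k w ^+ 2.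
  apply: le_trans (sqr_sum_le _ _ _) _; apply: ler_pM.
  - exact: sumr_ge0.
  - by apply: sumr_ge0 => k _; rewrite mulr_ge0 ?sqr_ge0.
  - rewrite (le_trans (ler_sum _ (fun k _ => g1 k)))//.
    by rewrite big_const_seq count_predT iter_addr_0 size_window.
  - by apply: ler_sum => k _; rewrite ler_piMl ?sqr_ge0.
have uB : u ^+ 2 <= b ^+ 2 * gain ^+ 4.
  rewrite (_ : gain ^+ 4 = (gain ^+ 2) ^+ 2); last by rewrite -exprM.
  have b0 : 0 <= b by apply: le_trans (ab (leq0n n)).
  have bg0 : 0 <= b * gain ^+ 2 by apply: mulr_ge0 => //; exact: sqr_ge0.
  rewrite -exprMn -[u ^+ 2]real_normK ?num_real// lerXn2r ?nnegrE//.
   rewrite /u; apply: le_trans (ler_norm_sum _ _ _) _.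
  apply: (@le_trans _ _ (\sum_(k <- window n) b * `|cov k i j|)).
    rewrite !big_seq; apply: ler_sum => k /mem_window kn.
    rewrite !normrM; apply: le_trans (ler_piMl _ (g1 k)) _; first by rewrite mulr_ge0.
    by rewrite ler_wpM2r// ab.
  by rewrite -mulr_sumr ler_wpM2l// -symsumE.
have xB : x ^+ 2 <= tail ^+ 2.
  rewrite -[x ^+ 2]real_normK ?num_real// lerXn2r ?nnegrE//.
  exact: le_trans Lt.
set V := amax ^+ 2 * _.
apply: (@le_trans _ _ (E (fun w => 3 * (tail ^+ 2 + b ^+ 2 * gain ^+ 4) +
    3 * (2 * n).+1%:R * \sum_(k <- window n) deviation k w ^+ 2))).
  apply: le_Rintegral => //.
  - by case: D2.
  - by apply: L1_add; [exact: L1_cst|apply: L1_scale; exact: L1_sum].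
  move=> w _; rewrite DE; move: (zB w) uB xB.
  set s := _%:R * \sum_(k <- _) _; rewrite -mulrA -/s => zs us xs.
  (* These three squares add up to [3 (x^2 + u^2 + z^2) - (x + u - z)^2]. *)
  have := sqr_ge0 (x - u); have := sqr_ge0 (x + z w); have := sqr_ge0 (u + z w); lra.
have isum : L1 P (fun w => \sum_(k <- window n) deviation k w ^+ 2) by exact: L1_sum.
rewrite RintegralD; [|by []|exact: L1_cst|exact: L1_scale].
rewrite E_cst RintegralZl//.
rewrite E_sum// [leRHS]mulrDr lerD2l -!mulrA ler_wpM2l// ler_wpM2l//.
apply: (@le_trans _ _ (\sum_(k <- window n) V)).
  rewrite !big_seq; apply: ler_sum => k /mem_window kn.
  exact: (deviation_le k).2 kn.
by rewrite big_const_seq count_predT iter_addr_0 size_window mulr_natl.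
Qed.

End Estimation.

Lemma frobC_sqr (R : realType) m n (A : 'M[R[i]%C]_(m, n)) :
  frobC A ^+ 2 = \sum_(z : 'I_m * 'I_n)
    (complex.Re (A z.1 z.2) ^+ 2 + complex.Im (A z.1 z.2) ^+ 2).
Proof.
rewrite sqr_sqrtr; last first.
  by apply: sumr_ge0 => i _; apply: sumr_ge0 => j _; exact: sqr_ge0.
rewrite pair_big/=; apply: eq_bigr => z _.
case: (A z.1 z.2) => u v /=.
by rewrite sqr_sqrtr// addr_ge0// sqr_ge0.
Qed.

(** * Uniform consistency for general lag weights *)

Section Consistency.
Context d (T : measurableType d) (R : realType) (P : probability T R) (m p : nat).
Context (M : int -> 'M[R]_(m, p)) (e : int -> T -> 'cV[R]_p) (y : int -> T -> 'cV[R]_m).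
Hypotheses (hM1 : cvgn (series (fun s : nat => frob (M s%:Z))))
  (he : white_gaussian_noise P e) (hy : linear_process P M e y).
Local Notation E X := (Rintegral P setT X).
Local Notation B0 := (2 * (8 * 58 * 8 ^+ 2 + 8 * 98 ^+ 2) + 2 : R).
Local Notation cov := (process_cov P y).
Local Notation gain := (gain M).
Local Notation part h theta i j := (symsum (fun k => h (- (theta * k%:~R)) * cov k i j)).

Lemma symsum_normr_cov_le i j n : symsum (fun k => `|cov k i j|) n <= gain ^+ 2.
Proof.
by rewrite symsumE; apply: (sum_process_cov_le hM1 he hy); exact: window_uniq.
Qed.

Lemma symsum_normr_cov_cvg i j : cvgn (symsum (fun k => `|cov k i j|)).
Proof.
have h k : symsum (fun l => `| `|cov l i j| |) k <= gain ^+ 2.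
  rewrite (_ : symsum _ k = symsum (fun l => `|cov l i j|) k).
    exact: symsum_normr_cov_le.
  by rewrite /symsum; apply: eq_bigr => l _; rewrite normr_id.
have n1 (k : int) : `|(1 : R)| <= 1 by rewrite normr1.
have [+ _] := @symsum_limit R (fun=> 1) (fun l => `|cov l i j|) _ 0 n1 h.
rewrite (_ : (fun l => 1 * `|cov l i j|) = (fun l => `|cov l i j|))//.
by apply/funext => l; rewrite mul1r.
Qed.

(** The [limn] in [spectral_density] is informative only when the partial sums converge; both parts
    do, as the covariances are absolutely summable. *)
Lemma spectral_densityE t theta i j :
  spectral_density (autocov P y t) theta i j =
  (limn (part cos theta i j) +i* limn (part sin theta i j))%C.
Proof.
rewrite mxE.
have cvg_part (h : R -> R) : (forall x, `|h x| <= 1) -> cvgn (part h theta i j).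
  move=> h1; exact: (@symsum_limit R (fun k => h (- (theta * k%:~R))) (fun k => cov k i j)
    _ 0 (fun k => h1 _) (symsum_normr_cov_le i j)).1.
rewrite -(lim_complex (cvg_part _ (@cos_max R)) (cvg_part _ (@sin_max R))).
set u := fun n => fourier_sum _ _ _ _ _; set v := fun n => (_ +i* _)%C.
suff -> : u = v by [].
apply/funext => n; rewrite /u /v fourier_sumE.
by congr (_ +i* _)%C; apply: eq_bigr => l _; rewrite (autocovE he hy).
Qed.

Variables (f : nat -> nat) (a : nat -> nat -> R) (t0 : int).
Hypotheses (hf : f @ \oo --> \oo)
  (hf2 : ((f N)%:R ^+ 2 / N%:R : R) @[N --> \oo] --> (0 : R)).
(** What the two estimators share. The condition [2 n <= N] serves the unbiased weights, whose size
    is then at most [2 / N]; the bias bound serves the biased ones and has the form of the ratio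
    assumed to vanish. *)
Hypothesis ha : forall N n k, (0 < N)%N -> (k <= n)%N -> (n < N)%N -> (2 * n <= N)%N ->
  0 <= a N k <= 2 / N%:R /\ `|1 - (N - k)%:R * a N k| <= n%:R ^+ 2 / N%:R.

Local Notation tail i j n :=
  (limn (symsum (fun l => `|cov l i j|)) - symsum (fun l => `|cov l i j|) n).
Local Notation rho N := ((f N)%:R ^+ 2 / N%:R : R).

(** The constant 36 is [9 * 4]: [(2n + 1)^2 <= 9 n^2] for [n >= 1], and the squared weight bound
    [2 / N] times [N] is [4 / N]. *)
Definition component_bound (i j : 'I_m) N : R :=
  3 * (tail i j (f N) ^+ 2 + rho N ^+ 2 * gain ^+ 4 + 36 * rho N * (gain ^+ 4 * B0)).

Lemma component_bound_cvg i j : component_bound i j N @[N --> \oo] --> (0 : R).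
Proof.
have -> : 0 = 3 * ((limn (symsum (fun l => `|cov l i j|)) -
    limn (symsum (fun l => `|cov l i j|))) ^+ 2 + 0 ^+ 2 * gain ^+ 4 + 36 * 0 * (gain ^+ 4 * B0)) :> R.
  by rewrite subrr; ring.
apply: cvgMr; apply: cvgD; first apply: cvgD.
- have h : tail i j (f N) @[N --> \oo] --> limn (symsum (fun l => `|cov l i j|)) -
    limn (symsum (fun l => `|cov l i j|)).
    apply: cvgB; first exact: cvg_cst.
    apply: (cvg_comp f (symsum (fun l => `|cov l i j|)) hf).
    exact: symsum_normr_cov_cvg.
  by under eq_fun do rewrite expr2; rewrite expr2; exact: cvgM.
- by apply: cvgMl; under eq_fun do rewrite expr2; rewrite expr2; exact: cvgM.
- by apply: cvgMl; exact: cvgMr.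
Qed.

Lemma consistent_of_weights :
  uniformly_ms_consistent P
    (truncated_periodogram (fun N k w => a N k *: lag_sum y N k w) f)
    (spectral_density (autocov P y t0)).
Proof.
move=> eps eps0.
(* The factor 2 counts the real and the imaginary part. As [theta] does not occur, the threshold for
   [N] can be fixed before it. *)
pose c N := \sum_(z : 'I_m * 'I_m) 2 * component_bound z.1 z.2 N.
have c0 : c N @[N --> \oo] --> (0 : R).
  have -> : 0 = \sum_(z : 'I_m * 'I_m) 2 * 0 :> R by rewrite big1// => z _; rewrite mulr0.
  by apply: cvgr_sum => z; apply: cvgMr; exact: component_bound_cvg.
have q0 : (0 : R) < 4^-1 by rewrite invr_gt0.
have hn : \forall N \near \oo, (0 < f N)%N by exact: (hf (nbhs_infty_gt 0)).
near=> N => theta _.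
have N0 : (0 < N)%N by near: N; exact: nbhs_infty_gt.
have n0 : (0 < f N)%N by near: N.
have cN : c N < eps by near: N; exact: (cvgr_lt (0 : R) c0).
have rN : rho N < 4^-1 by near: N; exact: (cvgr_lt (0 : R) hf2).
have N0' : (0 : R) < N%:R by rewrite ltr0n.
(* From [rho N < 1/4] and [f N >= 1]: [2 n <= 4 n^2 < N]. *)
have nN : (2 * f N <= N)%N.
  have : 4 * (f N)%:R ^+ 2 < N%:R :> R by move: rN; rewrite ltr_pdivrMr//; lra.
  by rewrite -natrX -natrM ltr_nat; nia.
have nN' : (f N < N)%N by lia.
set n := f N in n0 rN nN nN' *.
pose G (h : R -> R) (z : 'I_m * 'I_m) w := limn (part h theta z.1 z.2) -
  symsum (fun k => h (- (theta * k%:~R)) *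
    two_sided (fun k => a N k *: lag_sum y N k w) k z.1 z.2) n.
have GP (h : R -> R) z : (forall x, `|h x| <= 1) ->
    L2 P (G h z) /\ E (fun w => G h z w ^+ 2) <= component_bound z.1 z.2 N.
  move=> h1.
  have [] := @E_component_le _ _ _ P _ _ M e y hM1 he hy (a N) N n z.1 z.2 (2 / N%:R)
    (rho N) nN' (fun k kn => (ha N0 kn nN' nN).1) (fun k kn => (ha N0 kn nN' nN).2)
    (fun k => h (- (theta * k%:~R))) (fun k => h1 _).
  move=> G2 GB; split => //; apply: le_trans GB _.
  rewrite /component_bound ler_wpM2l// lerD2l.
  have gB : 0 <= gain ^+ 4 * B0 by rewrite mulr_ge0 ?exprn_ge0 ?gain_ge0//; lra.
  rewrite [leLHS](_ : _ = (2 * n).+1%:R ^+ 2 * 4 / N%:R * (gain ^+ 4 * B0)); last first.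
    by field; rewrite gt_eqF.
  apply: ler_wpM2r => //.
  rewrite mulrA; apply: ler_wpM2r; first by rewrite invr_ge0 ltW.
  rewrite -!natrX -!natrM ler_nat; nia.
have GE w : frobC (spectral_density (autocov P y t0) theta -
    truncated_periodogram (fun N k w => a N k *: lag_sum y N k w) f N theta w) ^+ 2 =
    \sum_(z : 'I_m * 'I_m) (G cos z w ^+ 2 + G sin z w ^+ 2).
  rewrite frobC_sqr; apply: eq_bigr => z _.
  have subE (A B : 'M[R[i]%C]_m) u v : (A - B) u v = A u v - B u v by rewrite !mxE.
  by rewrite subE spectral_densityE /truncated_periodogram fourier_sumE.
have iG z : L1 P (fun w => G cos z w ^+ 2 + G sin z w ^+ 2).
  apply: L1_add.
  - by have [[]] := GP cos z (@cos_max _).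
  - by have [[]] := GP sin z (@sin_max _).
rewrite unlock; under eq_integral do rewrite GE.
rewrite -EFin_E; last exact: L1_sum.
rewrite lte_fin; apply: le_lt_trans cN.
rewrite E_sum//; apply: ler_sum => z _.
have [[_ c2] cB] := GP cos z (@cos_max _); have [[_ s2] sB] := GP sin z (@sin_max _).
by rewrite RintegralD// mulrDl mul1r lerD.
Unshelve. all: by end_near. Qed.

End Consistency.

Unset Implicit Arguments.

Theorem theorem1 (R : realType) (d : measure_display) (T : measurableType d)
  (P : probability T R) (m p : nat) (hm : (0 < m)%N) (hp : (0 < p)%N)
  (M : int -> 'M[R]_(m, p))
  (hM0 : forall s : int, s < 0 -> M s = 0)
  (hM1 : cvgn (series (fun s : nat => frob (M s%:Z))))
  (e : int -> T -> 'cV[R]_p) (he : white_gaussian_noise P e)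
  (y : int -> T -> 'cV[R]_m) (hy : linear_process P M e y)
  (t0 : int)
  (f : nat -> nat) (hf : f @ \oo --> \oo)
  (hf2 : ((f N)%:R ^+ 2 / N%:R : R) @[N --> \oo] --> (0 : R)) :
  let Phi := spectral_density (autocov P y t0) in
  uniformly_ms_consistent P (truncated_periodogram (unbiased_scov y) f) Phi /\
  uniformly_ms_consistent P (truncated_periodogram (biased_scov y) f) Phi.
Proof.
move=> Phi; split.
- apply: (consistent_of_weights hM1 he hy (a := fun N k => (N - k)%:R^-1) t0 hf hf2).
  move=> N n k N0 kn nN nN2.
  have Nk0 : (0 : R) < (N - k)%:R by rewrite ltr0n subn_gt0; lia.
  have N0' : (0 : R) < N%:R by rewrite ltr0n.
  (* There is no bias here, and [N - k >= N / 2] because [k <= n] and [2 n <= N]. *)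
  split; last by rewrite divff ?gt_eqF// subrr normr0 divr_ge0 ?sqr_ge0.
  rewrite invr_ge0 ltW//= ler_pdivlMr// mulrC ler_pdivrMr//.
  by rewrite -natrM ler_nat; lia.
- apply: (consistent_of_weights hM1 he hy (a := fun N k => N%:R^-1) t0 hf hf2).
  move=> N n k N0 kn nN nN2.
  have N0' : (0 : R) < N%:R by rewrite ltr0n.
  have iN : (0 : R) <= N%:R^-1 by rewrite invr_ge0 ltW.
  split; first by apply/andP; split => //; lra.
  (* The relative bias is [k / N], and [k <= n <= n^2] for a natural number [n]. *)
  rewrite natrB; last by lia.
  rewrite mulrBl divff ?gt_eqF// opprB addrC subrK ger0_norm ?divr_ge0//.
  apply: ler_wpM2r; first by rewrite invr_ge0 ltW.
  by rewrite -natrX ler_nat; nia.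
Qed.
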